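(* Let $(F,H)$ be a permissible pair, and let $\mathbb A$, $\mathbb B$ and $\mathbb E$ be three $(F,H)$-metrized quantum vector bundles, with base spaces $(\mathfrak A,\mathsf L_{\mathfrak A})$, $(\mathfrak B,\mathsf L_{\mathfrak B})$, $(\mathfrak E,\mathsf L_{\mathfrak E})$ and $\mathbb B=(\mathscr M,\langle\cdot,\cdot\rangle_{\mathscr M},\mathsf D_{\mathscr M},\mathfrak B,\mathsf L_{\mathfrak B})$. Let $\tau_1=(\mathbb D_1,(\theta_{\mathfrak A},\Theta_{\mathfrak A}),(\theta_{\mathfrak B},\Theta_{\mathfrak B}))$ be an $(F,H)$-modular tunnel from $\mathbb A$ to $\mathbb B$ with $\mathbb D_1=(\mathscr P,\langle\cdot,\cdot\rangle_{\mathscr P},\mathsf D_1,\mathfrak D_1,\mathsf L^1)$, and let $\tau_2=(\mathbb D_2,(\pi_{\mathfrak B},\Pi_{\mathfrak B}),(\pi_{\mathfrak E},\Pi_{\mathfrak E}))$ be an $(F,H)$-modular tunnel from $\mathbb B$ to $\mathbb E$ with $\mathbb D_2=(\mathscr R,\langle\cdot,\cdot\rangle_{\mathscr R},\mathsf D_2,\mathfrak D_2,\mathsf L^2)$. Let $\varepsilon>0$. Let $\mathfrak D=\mathfrak D_1\oplus\mathfrak D_2$ and, for $(d_1,d_2)\in\mathfrak{sa}(\mathfrak D)$, $$\mathsf L(d_1,d_2)=\max\Big\{\mathsf L^1(d_1),\mathsf L^2(d_2),\tfrac1\varepsilon\|\theta_{\mathfrak B}(d_1)-\pi_{\mathfrak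 B}(d_2)\|_{\mathfrak B}\Big\}.$$ Let $\mathscr B=\mathscr P\oplus\mathscr R$, seen as a Hilbert $\mathfrak D$-module with $(d_1,d_2)\cdot(\omega_1,\omega_2)=(d_1\omega_1,d_2\omega_2)$ and $\langle(\omega_1,\omega_2),(\eta_1,\eta_2)\rangle_{\mathscr B}=(\langle\omega_1,\eta_1\rangle_{\mathscr P},\langle\omega_2,\eta_2\rangle_{\mathscr R})$. For $(\omega,\eta)\in\mathscr B$ let $$\mathsf D(\omega,\eta)=\max\Big\{\mathsf D_1(\omega),\mathsf D_2(\eta),\tfrac1\varepsilon\|\Theta_{\mathfrak B}(\omega)-\Pi_{\mathfrak B}(\eta)\|_{\mathscr M}\Big\}.$$ Let $\chi_{\mathfrak A}:(d_1,d_2)\in\mathfrak D\mapsto\theta_{\mathfrak A}(d_1)$, $\Xi_{\mathfrak A}:(\omega,\eta)\in\mathscr B\mapsto\Theta_{\mathfrak A}(\omega)$, $\upsilon_{\mathfrak E}:(d_1,d_2)\in\mathfrak D\mapsto\pi_{\mathfrak E}(d_2)$, $\Upsilon_{\mathfrak E}:(\omega,\eta)\in\mathscr B\mapsto\Pi_{\mathfrak E}(\eta)$. If $\mathbb D=(\mathscr B,\langle\cdot,\cdot\rangle_{\mathscr B},\mathsf D,\mathfrak D,\mathsf L)$ and $\tau=(\mathbb D,(\chi_{\mathfrak A},\Xi_{\mathfrak A}),(\upsilon_{\mathfrak E},\Upsilon_{\mathfrak E}))$, then $\mathbb D$ is an $(F,H)$-metrized quantum vector bundle, and $\tau$ is a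 modular tunnel from $\mathbb A$ to $\mathbb E$ of extent at most $\chi(\tau_1)+\chi(\tau_2)+\varepsilon$.
   Context: **Basics.** For a unital C*-algebra $\mathfrak A$: $\mathfrak{sa}(\mathfrak A)$ is the set of self-adjoint elements, $\mathscr S(\mathfrak A)$ the state space, $1_{\mathfrak A}$ the unit, $\Re a=\frac12(a+a^* )$, $\Im a=\frac1{2i}(a-a^* )$. $\|\cdot\|_E$ is the norm of a normed space $E$. Densely defined (semi)norms are given the value $\infty$ off their domain $\mathrm{dom}(\cdot)$. $\mathrm{Haus}_d$ is the Hausdorff distance for a metric $d$. A function $F:[0,\infty)^4\to[0,\infty)$ is *permissible* if it is weakly increasing for the product order and $F(x,y,l_x,l_y)\ge x l_y+y l_x$. A pair $(F,H)$ is *permissible* if $F$ is permissible and $H:[0,\infty)^2\to[0,\infty)$ is weakly increasing for the product order with $H(x,y)\ge 2xy$. An *$F$-quasi-Leibniz quantum compact metric space* $(\mathfrak A,\mathsf L)$ is a unital C*-algebra $\mathfrak A$ with a seminorm $\mathsf L$ on a dense Jordan–Lie subalgebra $\mathrm{dom}(\mathsf L)$ of $\mathfrak{sa}(\mathfrak A)$ (a real subspace stable under $(a,b)\mapsto\Re(ab),\Im(ab)$) such that: (1) $\{a\in\mathrm{dom}(\mathsf L):\mathsf L(a)=0\}=\mathbb R1_{\mathfrak A}$; (2) $\mathsf{mk}_{\mathsf L}(\varphi,\psi)=\sup\{|\varphi(a)-\psi(a)|:\mathsf L(a)\le1\}$ metrizes the weak* topology of $\mathscr S(\mathfrak A)$;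 (3) $\mathsf L$ is lower semi-continuous for $\|\cdot\|_{\mathfrak A}$; (4) $\max\{\mathsf L(\Re(ab)),\mathsf L(\Im(ab))\}\le F(\|a\|_{\mathfrak A},\|b\|_{\mathfrak A},\mathsf L(a),\mathsf L(b))$ for $a,b\in\mathrm{dom}(\mathsf L)$. A *quantum isometry* $\pi:(\mathfrak A,\mathsf L_{\mathfrak A})\to(\mathfrak B,\mathsf L_{\mathfrak B})$ is a surjective unital *-morphism with $\mathsf L_{\mathfrak B}(b)=\inf\{\mathsf L_{\mathfrak A}(a):a\in\mathfrak{sa}(\mathfrak A),\pi(a)=b\}$ for all $b\in\mathfrak{sa}(\mathfrak B)$. A *Hilbert $\mathfrak A$-module* $(\mathscr M,\langle\cdot,\cdot\rangle_{\mathscr M})$ is a left $\mathfrak A$-module with a sesquilinear $\mathfrak A$-valued map satisfying $\langle a\omega,\eta\rangle=a\langle\omega,\eta\rangle$, $\langle\omega,\eta\rangle=\langle\eta,\omega\rangle^*$, $\langle\omega,\omega\rangle\ge0$ with equality to $0$ iff $\omega=0$, complete for $\|\omega\|_{\mathscr M}=\|\langle\omega,\omega\rangle_{\mathscr M}\|_{\mathfrak A}^{1/2}$. A *Hilbert module morphism* $(\theta,\Theta)$ from a Hilbert $\mathfrak A$-module $\mathscr M$ to a Hilbert $\mathfrak B$-module $\mathscr N$ is a unital *-morphism $\theta:\mathfrak A\to\mathfrak B$ and a linear $\Theta:\mathscr M\to\mathscr N$ with $\Theta(a\omega)=\theta(a)\Theta(\omega)$ and $\theta(\langle\omega,\eta\rangle_{\mathscr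 M})=\langle\Theta\omega,\Theta\eta\rangle_{\mathscr N}$. An *$(F,H)$-metrized quantum vector bundle* $(\mathscr M,\langle\cdot,\cdot\rangle_{\mathscr M},\mathsf D,\mathfrak A,\mathsf L)$ consists of an $F$-quasi-Leibniz quantum compact metric space $(\mathfrak A,\mathsf L)$ (its base space), a Hilbert $\mathfrak A$-module $\mathscr M$, and a norm $\mathsf D$ on a dense $\mathbb C$-subspace $\mathrm{dom}(\mathsf D)$ of $\mathscr M$ with: $\|\omega\|_{\mathscr M}\le\mathsf D(\omega)$; $\{\omega:\mathsf D(\omega)\le1\}$ is compact for $\|\cdot\|_{\mathscr M}$; and $\max\{\mathsf L(\Re\langle\omega,\eta\rangle_{\mathscr M}),\mathsf L(\Im\langle\omega,\eta\rangle_{\mathscr M})\}\le H(\mathsf D(\omega),\mathsf D(\eta))$ for $\omega,\eta\in\mathrm{dom}(\mathsf D)$. A *modular quantum isometry* from $(\mathscr M,\dots,\mathsf D_{\mathscr M},\mathfrak A,\mathsf L_{\mathfrak A})$ to $(\mathscr N,\dots,\mathsf D_{\mathscr N},\mathfrak B,\mathsf L_{\mathfrak B})$ is a Hilbert module morphism $(\theta,\Theta)$ with $\theta$ a quantum isometry, $\Theta$ surjective and $\mathsf D_{\mathscr N}(\omega)=\inf\{\mathsf D_{\mathscr M}(\eta):\Theta(\eta)=\omega\}$ for all $\omega\in\mathscr N$. **Tunnels.** An *$(F,H)$-modular tunnel* $\tau=(\mathbb D,(\theta_1,\Theta_1),(\theta_2,\Theta_2))$ from $\mathbb A_1$ to $\mathbb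 A_2$ is an $(F,H)$-metrized quantum vector bundle $\mathbb D$, with base space $(\mathfrak D,\mathsf L)$, and modular quantum isometries $(\theta_j,\Theta_j)$ from $\mathbb D$ to $\mathbb A_j$. With $(\mathfrak A_j,\mathsf L_j)$ the base space of $\mathbb A_j$, its *extent* is $\chi(\tau)=\max_{j=1,2}\mathrm{Haus}_{\mathsf{mk}_{\mathsf L}}(\mathscr S(\mathfrak D),\{\varphi\circ\theta_j:\varphi\in\mathscr S(\mathfrak A_j)\})$. *)

(* Defs.v *)
From HB Require Import structures.
From mathcomp Require Import all_boot all_order all_algebra.
From mathcomp Require Import complex.
From mathcomp Require Import all_classical all_reals all_analysis.
Set Implicit Arguments.
Unset Strict Implicit.
Unset Printing Implicit Defensive.
Import Order.TTheory GRing.Theory Num.Theory.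
Import numFieldNormedType.Exports.
Local Open Scope classical_set_scope.
Local Open Scope complex_scope.
Local Open Scope ring_scope.

(* The library's product of normed modules has the max norm; it lacks the
   completeness instance. *)
HB.saturate prod.

Section ProductComplete.
Variables (K : numFieldType) (U V : completeNormedModType K).

Lemma prod_cauchy_cvg (G : set_system (U * V)%type) :
  ProperFilter G -> cauchy G -> cvg G.
Proof.
move=> GG /cauchy_ballP cG.
have c1 : cvg (fst @ G).
  apply: cauchy_cvg; apply/cauchy_ballP => e e0.
  have [[P Q] /= [GP GQ] PQ] := cG e e0.
  exists (fst @` P, fst @` Q) => /=.
    by split; [apply: filterS GP|apply: filterS GQ] => x Px; exists x.
  by move=> [_ _] /= [[x Px <-] [y Qy <-]]; have [] := PQ (x, y) (conj Px Qy).
have c2 : cvg (snd @ G).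
  apply: cauchy_cvg; apply/cauchy_ballP => e e0.
  have [[P Q] /= [GP GQ] PQ] := cG e e0.
  exists (snd @` P, snd @` Q) => /=.
    by split; [apply: filterS GP|apply: filterS GQ] => x Px; exists x.
  by move=> [_ _] /= [[x Px <-] [y Qy <-]]; have [] := PQ (x, y) (conj Px Qy).
apply/cvg_ex; exists (lim (fst @ G), lim (snd @ G)) => A nA.
have GA : G [set x | A (x.1, x.2)] by exact: (cvg_pair c1 c2 nA).
by apply: (filterS _ GA) => -[].
Qed.

End ProductComplete.

HB.instance Definition _ (K : numFieldType) (U V : completeNormedModType K) :=
  Uniform_isComplete.Build (U * V)%type (@prod_cauchy_cvg K U V).

Lemma prod_norm_le (K : numDomainType) (U V : normedZmodType K)
    (x : (U * V)%type) (c : K) :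
  (`|x| <= c) = (`|x.1| <= c) && (`|x.2| <= c).
Proof. by rewrite prod_normE comparable_ge_max // real_comparable. Qed.

Lemma nneg_homo_max (K : numDomainType) (f : K -> K) (x y : K) :
  (forall u v, 0 <= u -> u <= v -> f u <= f v) -> 0 <= x -> 0 <= y ->
  f (Num.max x y) = Num.max (f x) (f y).
Proof.
move=> fm x0 y0; have [xy|/ltW yx] := real_leP (ger0_real x0) (ger0_real y0).
  by rewrite max_r // fm.
by rewrite max_l // fm.
Qed.

(* Unital algebras, with 1 != 0. Hierarchy-Builder admits no join of rings and
   normed modules besides the number structures, so the product is a field of
   the mixin, and the library's ring and algebra structures are derived from
   it. The norm of a module normed over R[i] takes its values in R[i]; see
   [rnorm]. *)
HB.mixin Record isCStar (R : realType) A of CompleteNormedModule R[i] A := {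
  cmul : A -> A -> A;
  cone : A;
  star : A -> A;
  cmulA : associative cmul;
  cmul1r : left_id cone cmul;
  cmulr1 : right_id cone cmul;
  cmulDl : left_distributive cmul +%R;
  cmulDr : right_distributive cmul +%R;
  cone_neq0 : cone != 0;
  cscaleAl : forall (z : R[i]) (a b : A), z *: cmul a b = cmul (z *: a) b;
  cscaleAr : forall (z : R[i]) (a b : A), z *: cmul a b = cmul a (z *: b);
  starK : involutive star;
  starD : {morph star : a b / a + b};
  starZ : forall (z : R[i]) (a : A), star (z *: a) = z^*%C *: star a;
  starM : forall a b : A, star (cmul a b) = cmul (star b) (star a);
  cstar_normM : forall a b : A, `|cmul a b| <= `|a| * `|b|;
  cstar_normE : forall a : A, `|cmul (star a) a| = `|a| ^+ 2
}.

#[short(type="cstarType")]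
HB.structure Definition CStar (R : realType) :=
  {A of isCStar R A & CompleteNormedModule R[i] A}.

Section CStarAlgebra.
Variables (R : realType) (A : cstarType R).

#[non_forgetful_inheritance]
HB.instance Definition _ := GRing.Zmodule_isNzRing.Build A
  (@cmulA R A) (@cmul1r R A) (@cmulr1 R A) (@cmulDl R A) (@cmulDr R A)
  (@cone_neq0 R A).

#[non_forgetful_inheritance]
HB.instance Definition _ :=
  GRing.LSemiModule_isLSemiAlgebra.Build R[i] A (@cscaleAl R A).

#[non_forgetful_inheritance]
HB.instance Definition _ :=
  GRing.LSemiAlgebra_isSemiAlgebra.Build R[i] A (@cscaleAr R A).

End CStarAlgebra.

Section DirectSumCStar.
Variables (R : realType) (A B : cstarType R).
Implicit Types x y : (A * B)%type.

Definition pair_star x : (A * B)%type := (star x.1, star x.2).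

Lemma pair_starK : involutive pair_star.
Proof. by case=> a b; rewrite /pair_star /= !starK. Qed.

Lemma pair_starD : {morph pair_star : x y / x + y}.
Proof. by move=> x y; rewrite /pair_star /= !starD. Qed.

Lemma pair_starZ (z : R[i]) x : pair_star (z *: x) = z^*%C *: pair_star x.
Proof. by rewrite /pair_star /= !starZ. Qed.

Lemma pair_starM x y : pair_star (x * y) = pair_star y * pair_star x.
Proof. by rewrite /pair_star /= !starM. Qed.

Lemma pair_normM x y : `|x * y| <= `|x| * `|y|.
Proof.
have /andP[x1 x2] : (`|x.1| <= `|x|) && (`|x.2| <= `|x|).
  by rewrite -prod_norm_le.
have /andP[y1 y2] : (`|y.1| <= `|y|) && (`|y.2| <= `|y|).
  by rewrite -prod_norm_le.
by rewrite prod_norm_le; apply/andP; split;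
  apply: le_trans (cstar_normM _ _) _; rewrite ler_pM.
Qed.

Lemma pair_normE x : `|pair_star x * x| = `|x| ^+ 2.
Proof.
rewrite !prod_normE /= !cstar_normE (nneg_homo_max (f := fun u => u ^+ 2)) //.
by move=> u v u0 uv; rewrite lerXn2r // nnegrE // (le_trans u0).
Qed.

HB.instance Definition _ := isCStar.Build R (A * B)%type
  (@mulrA (A * B)%type) (@mul1r (A * B)%type) (@mulr1 (A * B)%type)
  (@mulrDl (A * B)%type) (@mulrDr (A * B)%type) (@oner_neq0 (A * B)%type)
  (@scalerAl R[i] (A * B)%type) (@scalerAr R[i] (A * B)%type)
  pair_starK pair_starD pair_starZ pair_starM pair_normM pair_normE.

End DirectSumCStar.

(* Positivity of <w, w> is stated in the form b^* b. *)
HB.mixin Record isHilbertModule (R : realType) (A : cstarType R) M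
    of CompleteNormedModule R[i] M := {
  hact : A -> M -> M;
  hact1 : forall w, hact 1 w = w;
  hactM : forall a b w, hact (a * b) w = hact a (hact b w);
  hactDl : forall a b w, hact (a + b) w = hact a w + hact b w;
  hactDr : forall a w v, hact a (w + v) = hact a w + hact a v;
  hactZ : forall (z : R[i]) a w, hact (z *: a) w = z *: hact a w;
  inner : M -> M -> A;
  innerD : forall w w' v, inner (w + w') v = inner w v + inner w' v;
  inner_act : forall a w v, inner (hact a w) v = a * inner w v;
  innerC : forall w v, inner w v = star (inner v w);
  inner_ge0 : forall w, exists b : A, inner w w = star b * b;
  inner_eq0 : forall w, inner w w = 0 -> w = 0;
  inner_norm : forall w : M, `|w| = sqrtC `|inner w w|
}.

#[short(type="hilbertModType")]
HB.structure Definition HilbertModule (R : realType) (A : cstarType R) :=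
  {M of isHilbertModule R A M & CompleteNormedModule R[i] M}.

Section DirectSumHilbert.
Variables (R : realType) (A B : cstarType R).
Variables (M : hilbertModType A) (N : hilbertModType B).
Implicit Types (a b : (A * B)%type) (w v : (M * N)%type).

Definition pair_hact a w : (M * N)%type := (hact a.1 w.1, hact a.2 w.2).

Definition pair_inner w v : (A * B)%type := (inner w.1 v.1, inner w.2 v.2).

Lemma pair_hact1 w : pair_hact 1 w = w.
Proof. by case: w => w1 w2; rewrite /pair_hact /= !hact1. Qed.

Lemma pair_hactM a b w : pair_hact (a * b) w = pair_hact a (pair_hact b w).
Proof. by rewrite /pair_hact /= !hactM. Qed.

Lemma pair_hactDl a b w : pair_hact (a + b) w = pair_hact a w + pair_hact b w.
Proof. by rewrite /pair_hact /= !hactDl. Qed.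

Lemma pair_hactDr a w v : pair_hact a (w + v) = pair_hact a w + pair_hact a v.
Proof. by rewrite /pair_hact /= !hactDr. Qed.

Lemma pair_hactZ (z : R[i]) a w : pair_hact (z *: a) w = z *: pair_hact a w.
Proof. by rewrite /pair_hact /= !hactZ. Qed.

Lemma pair_innerD w w' v :
  pair_inner (w + w') v = pair_inner w v + pair_inner w' v.
Proof. by rewrite /pair_inner /= !innerD. Qed.

Lemma pair_inner_act a w v :
  pair_inner (pair_hact a w) v = a * pair_inner w v.
Proof. by rewrite /pair_inner /= !inner_act. Qed.

Lemma pair_innerC w v : pair_inner w v = star (pair_inner v w).
Proof. by rewrite /pair_inner innerC [X in (_, X)]innerC. Qed.

Lemma pair_inner_ge0 w : exists b, pair_inner w w = star b * b.
Proof.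
have [b1 e1] := inner_ge0 w.1; have [b2 e2] := inner_ge0 w.2.
by exists (b1, b2); rewrite /pair_inner e1 e2.
Qed.

Lemma pair_inner_eq0 w : pair_inner w w = 0 -> w = 0.
Proof. by case: w => w1 w2 [/inner_eq0 -> /inner_eq0 ->]. Qed.

Lemma pair_inner_norm w : `|w| = sqrtC `|pair_inner w w|.
Proof.
rewrite !prod_normE /= (nneg_homo_max (f := sqrtC)) ?inner_norm //.
by move=> u v u0 uv; rewrite ler_sqrtC // qualifE /= (le_trans u0).
Qed.

HB.instance Definition _ := isHilbertModule.Build R (A * B)%type (M * N)%type
  pair_hact1 pair_hactM pair_hactDl pair_hactDr pair_hactZ pair_innerD
  pair_inner_act pair_innerC pair_inner_ge0 pair_inner_eq0 pair_inner_norm.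

End DirectSumHilbert.

Definition rnorm (R : realType) (V : normedModType R[i]) (x : V) : R :=
  complex.Re `|x|.

Section CStarNotions.
Variables (R : realType) (A : cstarType R).
Implicit Types a b : A.

Definition sa : set A := [set a | star a = a].

Definition re_part a : A := (2 : R[i])^-1 *: (a + star a).

Definition im_part a : A := (2 * 'i%C : R[i])^-1 *: (a - star a).

(* Functionals take values in [R[i]^o], the alias carrying the topology. *)
Definition states : set (A -> R[i]^o) :=
  [set phi | [/\ linear phi, forall a, 0 <= phi (star a * a) :> R[i]
               & phi 1 = 1]].

End CStarNotions.

Arguments sa {R} A.
Arguments states {R} A.

Section Seminorms.
Variable R : realType.

Definition dom (V : Type) (N : V -> \bar R) : set V :=
  [set x | (N x < +oo)%E].

(* [N] is a seminorm, with respect to the scalars in [K], defined on the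
   subspace [dom N] and extended by +oo. The first two axioms and homogeneity
   make [dom N] a [K]-subspace. *)
Definition seminorm (V : lmodType R[i]) (K : set R[i]) (N : V -> \bar R) :=
  [/\ N 0 = 0%E,
      forall x y, (N (x + y)%R <= N x + N y)%E,
      forall x, (0 <= N x)%E &
      forall (k : R[i]) x, K k -> dom N x ->
        N (k *: x) = ((complex.Re `|k|)%:E * N x)%E].

End Seminorms.

Section Metrics.
Variable R : realType.

Definition metric_on (T : Type) (S : set T) (d : T -> T -> \bar R) : Prop :=
  [/\ forall x y, S x -> S y -> (0 <= d x y < +oo)%E,
      forall x y, S x -> S y -> (d x y = 0%E <-> x = y),
      forall x y, S x -> S y -> d x y = d y x &
      forall x y z, S x -> S y -> S z -> (d x z <= d x y + d y z)%E].

(* [d] is a metric on [S] inducing the topology of [S] as a subspace of [T]. *)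
Definition metrizes (T : topologicalType) (S : set T) (d : T -> T -> \bar R) :
    Prop :=
  metric_on S d /\
  forall x, S x -> forall X : set T,
    within S (nbhs x) X <->
    exists2 e : R, 0 < e & [set y | S y /\ (d x y < e%:E)%E] `<=` X.

Definition hausdorff_dist (T : Type) (d : T -> T -> \bar R) (X Y : set T) :
    \bar R :=
  maxe (ereal_sup [set ereal_inf [set d x y | y in Y] | x in X])
       (ereal_sup [set ereal_inf [set d x y | x in X] | y in Y]).

End Metrics.

Section Permissible.
Variable R : realType.

(* Only the values at nonnegative arguments matter. *)
Definition permissible_leibniz (F : R -> R -> R -> R -> R) : Prop :=
  (forall x y lx ly x' y' lx' ly' : R,
     0 <= x <= x' -> 0 <= y <= y' -> 0 <= lx <= lx' -> 0 <= ly <= ly' ->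
     F x y lx ly <= F x' y' lx' ly') /\
  (forall x y lx ly : R, 0 <= x -> 0 <= y -> 0 <= lx -> 0 <= ly ->
     x * ly + y * lx <= F x y lx ly).

Definition permissible (F : R -> R -> R -> R -> R) (H : R -> R -> R) : Prop :=
  [/\ permissible_leibniz F,
      forall x y x' y' : R, 0 <= x <= x' -> 0 <= y <= y' -> H x y <= H x' y' &
      forall x y : R, 0 <= x -> 0 <= y -> 2 * x * y <= H x y].

End Permissible.

Section QuantumMetric.
Variable R : realType.

Definition mk_dist (A : cstarType R) (L : A -> \bar R) (phi psi : A -> R[i]^o) :
    \bar R :=
  ereal_sup [set (rnorm (phi a - psi a))%:E | a in [set a | (L a <= 1)%E]].

Record is_qcms (F : R -> R -> R -> R -> R) (A : cstarType R)
    (L : A -> \bar R) : Prop := IsQcms {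
  qcms_sa : dom L `<=` sa A;
  qcms_dense : sa A `<=` closure (dom L);
  qcms_jordan_lie : forall a b, dom L a -> dom L b ->
    dom L (re_part (a * b)) /\ dom L (im_part (a * b));
  qcms_seminorm : seminorm [set t%:C | t in [set: R]] L;
  qcms_kernel : [set a | dom L a /\ L a = 0%E] = [set t%:C%:A | t in [set: R]];
  (* the weak* topology is the topology of pointwise convergence *)
  qcms_metrizes :
    @metrizes R {ptws A -> R[i]^o} (states A) (mk_dist L);
  qcms_lsc : lower_semicontinuous L;
  qcms_leibniz : forall a b, dom L a -> dom L b ->
    (maxe (L (re_part (a * b)%R)) (L (im_part (a * b)%R)) <=
     (F (rnorm a) (rnorm b) (fine (L a)) (fine (L b)))%:E)%E }.

Definition star_morphism (A B : cstarType R) (theta : A -> B) : Prop :=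
  [/\ linear theta, monoid_morphism theta &
      forall a, theta (star a) = star (theta a)].

Definition quantum_isometry (A B : cstarType R) (LA : A -> \bar R)
    (LB : B -> \bar R) (theta : A -> B) : Prop :=
  [/\ star_morphism theta, (forall b, exists a, theta a = b) &
      forall b, sa B b ->
        LB b = ereal_inf [set LA a | a in [set a | sa A a /\ theta a = b]]].

End QuantumMetric.

Section Bundles.
Variable R : realType.

(* The tuples (M, <.,.>, D, A, L), without their axioms; the inner product
   comes with [bundle_mod]. *)
Record bundle := Bundle {
  bundle_base : cstarType R;
  bundle_mod : hilbertModType bundle_base;
  bundle_D : bundle_mod -> \bar R;
  bundle_L : bundle_base -> \bar R }.

Arguments bundle_D : clear implicits.
Arguments bundle_L : clear implicits.

Record is_bundle (F : R -> R -> R -> R -> R) (H : R -> R -> R)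
    (X : bundle) : Prop := IsBundle {
  bundle_qcms : is_qcms F (bundle_L X);
  bundle_D_seminorm : seminorm [set: R[i]] (bundle_D X);
  bundle_D_eq0 : forall w, bundle_D X w = 0%E -> w = 0 :> bundle_mod X;
  bundle_D_dense : closure (dom (bundle_D X)) = [set: bundle_mod X];
  bundle_D_ge : forall w : bundle_mod X, ((rnorm w)%:E <= bundle_D X w)%E;
  bundle_D_compact : compact [set w : bundle_mod X | (bundle_D X w <= 1)%E];
  bundle_leibniz : forall w v : bundle_mod X,
    dom (bundle_D X) w -> dom (bundle_D X) v ->
    (maxe (bundle_L X (re_part (inner w v)))
          (bundle_L X (im_part (inner w v))) <=
     (H (fine (bundle_D X w)) (fine (bundle_D X v)))%:E)%E }.

Definition hilbert_morphism (A B : cstarType R) (M : hilbertModType A)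
    (N : hilbertModType B) (theta : A -> B) (Theta : M -> N) : Prop :=
  [/\ star_morphism theta, linear Theta,
      forall a w, Theta (hact a w) = hact (theta a) (Theta w) &
      forall w v, theta (inner w v) = inner (Theta w) (Theta v)].

Definition modular_isometry (X Y : bundle)
    (theta : bundle_base X -> bundle_base Y)
    (Theta : bundle_mod X -> bundle_mod Y) : Prop :=
  [/\ hilbert_morphism theta Theta,
      quantum_isometry (bundle_L X) (bundle_L Y) theta,
      (forall w, exists v, Theta v = w) &
      forall w,
        bundle_D Y w =
        ereal_inf [set bundle_D X v | v in [set v | Theta v = w]]].

Record tunnel (X Y : bundle) := Tunnel {
  tun_bundle : bundle;
  tun_base1 : bundle_base tun_bundle -> bundle_base X;
  tun_mod1 : bundle_mod tun_bundle -> bundle_mod X;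
  tun_base2 : bundle_base tun_bundle -> bundle_base Y;
  tun_mod2 : bundle_mod tun_bundle -> bundle_mod Y }.

Arguments tun_base1 {X Y} t.
Arguments tun_mod1 {X Y} t.
Arguments tun_base2 {X Y} t.
Arguments tun_mod2 {X Y} t.

Definition is_tunnel (F : R -> R -> R -> R -> R) (H : R -> R -> R)
    (X Y : bundle) (tau : tunnel X Y) : Prop :=
  [/\ is_bundle F H (tun_bundle tau),
      modular_isometry (tun_base1 tau) (tun_mod1 tau) &
      modular_isometry (tun_base2 tau) (tun_mod2 tau)].

Definition extent (X Y : bundle) (tau : tunnel X Y) : \bar R :=
  let d := mk_dist (bundle_L (tun_bundle tau)) in
  let S := states (bundle_base (tun_bundle tau)) in
  maxe
    (hausdorff_dist d S
      [set phi \o tun_base1 tau | phi in states (bundle_base X)])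
    (hausdorff_dist d S
      [set phi \o tun_base2 tau | phi in states (bundle_base Y)]).

End Bundles.

Arguments bundle_D {R} b.
Arguments bundle_L {R} b.
Arguments tun_base1 {R X Y} t.
Arguments tun_mod1 {R X Y} t.
Arguments tun_base2 {R X Y} t.
Arguments tun_mod2 {R X Y} t.

(* Main.v *)
Require Import Defs.
From HB Require Import structures.
From mathcomp Require Import all_boot all_order all_algebra.
From mathcomp Require Import complex ring lra.
From mathcomp Require Import all_classical all_reals all_analysis.
Import Order.TTheory GRing.Theory Num.Theory.
Import numFieldNormedType.Exports.
Set Implicit Arguments.
Unset Strict Implicit.
Unset Printing Implicit Defensive.
Local Open Scope classical_set_scope.
Local Open Scope complex_scope.
Local Open Scope ring_scope.

(** On the direct sum of the two tunnels, both [L] and [D] have the same form: the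
    maximum of the seminorms of the summands and of the norm, divided by [eps], of
    the gap between the two images in the common quotient [B] ([coupled]). The
    algebraic axioms, semicontinuity, density and compactness are inherited from
    the summands because the quotient maps are contractive ([mor_norm],
    [hmor_norm]). The Leibniz inequalities hold because the gap of a product is at
    most the sum of the products of the gap of one factor with the norm of the
    other; for inner products, this is the Cauchy-Schwarz inequality
    ([cauchy_schwarz]), and the factor [2] in the hypothesis on [H] accounts for
    the two terms.

    The two projections are isometries because a nearly optimal lift of an element
    to one summand, mapped to [B] and lifted to the other summand, gives a pair
    with gap [0] ([common_lift]).

    A state [phi] of the direct sum is a convex combination of states of the
    summands ([state_decomposition]). A state of the first summand is within the
    extent of the first tunnel of a state coming from [A]. A state of the second
    one is within the extent of the second tunnel of a state coming from [B]; seen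
    on the first summand, the latter has moved by at most [eps], and it is within
    the extent of the first tunnel of a state coming from [A]
    ([reach_through_quotient]). The convexity of the distance then gives the
    bound on the extent.

    That the Monge-Kantorovich distance of [L] metrizes the weak* topology is
    proved without compactness. Fix a state [mu] of [B]. Completing an element of
    one summand by the scalar that [mu] assigns to it turns a state of the direct
    sum into a state of this summand, and the distance between two states is at
    most the sum of the distances between the two pairs of states obtained in
    this way, plus [eps] times the difference of their weights
    ([coupled_mk_dist_le]). All three terms are finite and weak* continuous. The
    converse, that the distance controls the weak* topology, follows from the
    density of the domain of [L] ([mk_dist_controls]).

    These arguments rest on the order structure of C*-algebras, developed here
    from the norm alone: an element is positive when it is self-adjoint and at
    distance at most [t] from some scalar [t] ([cpos]). Such elements have square
    roots, obtained from a contraction; they form a closed cone, contain every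
    [x^* x] ([cpos_star_mul]), and order bounds give norm bounds. Contractivity of
    star-morphisms and the Cauchy-Schwarz inequality follow. Together with the
    Hahn-Banach theorem, [cpos_star_mul] also gives the existence of states
    ([states_nonempty]), without which the state [mu] above and the Hausdorff
    distances would make no sense. *)

(** * Real-valued norms and completeness *)

Lemma ler_eps (R : realType) (x y : R) :
  (forall d : R, 0 < d -> x <= y + d) -> x <= y.
Proof. by move=> xy; apply/ler_addgt0Pr. Qed.

Section RealNorm.
Variables (R : realType) (V : normedModType R[i]).
Implicit Types (x y : V) (t : R).

Lemma rnormE x : (rnorm x)%:C = `|x|.
Proof. by rewrite /rnorm RRe_real ?normr_real. Qed.

Lemma real_norm t : `|t%:C : R[i]| = `|t|%:C.
Proof. by rewrite normc_def /= expr0n /= addr0 sqrtr_sqr. Qed.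

Lemma rnorm_le x t : (`|x| <= t%:C) = (rnorm x <= t).
Proof. by rewrite -rnormE lecR. Qed.

Lemma rnorm_ge0 x : 0 <= rnorm x.
Proof. by rewrite -lecR rnormE normr_ge0. Qed.

Lemma rnorm0 : rnorm (0 : V) = 0.
Proof. by rewrite /rnorm normr0. Qed.

Lemma rnorm_eq0 x : rnorm x = 0 -> x = 0.
Proof. by move=> x0; apply/eqP; rewrite -normr_eq0 -rnormE x0. Qed.

Lemma rnormD x y : rnorm (x + y) <= rnorm x + rnorm y.
Proof. by rewrite -lecR rmorphD /= !rnormE ler_normD. Qed.

Lemma rnormN x : rnorm (- x) = rnorm x.
Proof. by rewrite /rnorm normrN. Qed.

Lemma rnormB x y : rnorm (x - y) <= rnorm x + rnorm y.
Proof. by rewrite -[rnorm y]rnormN rnormD. Qed.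

Lemma rnorm_distC x y : rnorm (x - y) = rnorm (y - x).
Proof. by rewrite /rnorm distrC. Qed.

Lemma rnorm_triangle y x z : rnorm (x - z) <= rnorm (x - y) + rnorm (y - z).
Proof. by rewrite -[x - z](subrKA y) rnormD. Qed.

Lemma rnormZc z x : rnorm (z *: x) = complex.Re `|z| * rnorm x.
Proof.
have zE : `|z| = (complex.Re `|z|)%:C by rewrite RRe_real ?normr_real.
by rewrite {1}/rnorm normrZ -rnormE zE -rmorphM.
Qed.

Lemma rnormZ t x : rnorm (t%:C *: x) = `|t| * rnorm x.
Proof. by rewrite rnormZc real_norm. Qed.

Lemma rnorm_small x (K : R) :
  (forall d : R, 0 < d -> rnorm x <= K * d) -> x = 0.
Proof.
move=> xs; apply: rnorm_eq0; apply/eqP; rewrite eq_le rnorm_ge0 andbT.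
apply: ler_eps => e e0; rewrite add0r.
have K1 : 0 < `|K| + 1 by rewrite ltr_wpDl.
apply: le_trans (xs _ (divr_gt0 e0 K1)) _.
rewrite mulrA ler_pdivrMr // mulrC ler_pM2l //.
by rewrite (le_trans (ler_norm _)) // lerDl.
Qed.

End RealNorm.

Section CauchyLimit.
Variables (R : realType) (V : completeNormedModType R[i]).

(** Completeness with a modulus: the limit is as close to the [n]th term as all
    later terms are. *)
Lemma cauchy_limit (x : nat -> V) (e : nat -> R) :
  (forall d : R, 0 < d -> exists n, e n < d) ->
  (forall n m, (n <= m)%N -> rnorm (x m - x n) <= e n) ->
  exists l, forall n, rnorm (l - x n) <= e n.
Proof.
move=> e0 xe.
have cx : cvg (x @ \oo).
  apply: cauchy_cvg; apply/cauchy_exP => d d0.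
  have dR : d = (complex.Re d)%:C by rewrite RRe_real // gtr0_real.
  have [n en] : exists n, e n < complex.Re d by apply: e0; rewrite -ltcR -dR.
  exists (x n); exists n => // m /= nm.
  rewrite -ball_normE /= -rnormE dR ltcR rnorm_distC.
  exact: le_lt_trans (xe _ _ nm) en.
exists (lim (x @ \oo)) => n; apply: ler_eps => d d0.
have dC : 0 < d%:C :> R[i] by rewrite ltcR.
have /cvgrPdist_lt/(_ _ dC)[N _ NP] := cx.
apply: le_trans (rnorm_triangle (x (maxn N n)) _ _) _.
rewrite addrC lerD ?xe ?leq_maxr // -lecR rnormE ltW //.
by apply: NP; rewrite /= leq_maxl.

Qed.

End CauchyLimit.

(** * Norm, involution and commutation in C*-algebras *)

Section CStarNorm.
Variables (R : realType) (A : cstarType R).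
Implicit Types (a b c x : A) (t : R).

Lemma rnormM a b : rnorm (a * b) <= rnorm a * rnorm b.
Proof. by rewrite -lecR rmorphM /= !rnormE cstar_normM. Qed.

Lemma rnorm_star_mul a : rnorm (star a * a) = rnorm a ^+ 2.
Proof. by apply: complexI; rewrite rmorphXn /= !rnormE cstar_normE. Qed.

Lemma rnorm_star a : rnorm (star a) = rnorm a.
Proof.
suff le b : rnorm b <= rnorm (star b).
  by apply/eqP; rewrite eq_le le -{2}[a]starK le.
have [b0|b0] := eqVneq (rnorm b) 0; first by rewrite b0 rnorm_ge0.
have b_gt0 : 0 < rnorm b by rewrite lt0r b0 rnorm_ge0.
by rewrite -(ler_pM2r b_gt0) -expr2 -rnorm_star_mul rnormM.
Qed.

Lemma rnorm_mul_star a : rnorm (a * star a) = rnorm a ^+ 2.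
Proof. by rewrite -{1}[a]starK rnorm_star_mul rnorm_star. Qed.

Lemma star0 : star (0 : A) = 0.
Proof. by apply: (addrI (star 0)); rewrite -starD !addr0. Qed.

Lemma starN a : star (- a) = - star a.
Proof. by apply: (addrI (star a)); rewrite -starD !subrr star0. Qed.

Lemma starB a b : star (a - b) = star a - star b.
Proof. by rewrite starD starN. Qed.

Lemma star_mul a b : star (a * b) = star b * star a.
Proof. exact: starM. Qed.

Lemma star1 : star (1 : A) = 1.
Proof. by rewrite -[LHS]mul1r -{1}[1]starK -star_mul mul1r starK. Qed.

Lemma starZr t a : star (t%:C *: a) = t%:C *: star a.
Proof. by rewrite starZ /= oppr0. Qed.

Lemma rnorm1 : rnorm (1 : A) = 1.
Proof.
have n1 : rnorm (1 : A) != 0.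
  by apply/eqP => /rnorm_eq0/eqP; rewrite oner_eq0.
by apply: (mulfI n1); rewrite mulr1 -expr2 -rnorm_star_mul star1 mulr1.
Qed.

Lemma rnorm_scalar t : rnorm (t%:C%:A : A) = `|t|.
Proof. by rewrite rnormZ rnorm1 mulr1. Qed.

Lemma saD a b : sa A a -> sa A b -> sa A (a + b).
Proof. by rewrite /sa /= starD => -> ->. Qed.

Lemma saN a : sa A a -> sa A (- a).
Proof. by rewrite /sa /= starN => ->. Qed.

Lemma saB a b : sa A a -> sa A b -> sa A (a - b).
Proof. by rewrite /sa /= starB => -> ->. Qed.

Lemma saZ t a : sa A a -> sa A (t%:C *: a).
Proof. by rewrite /sa /= starZr => ->. Qed.

Lemma sa_scalar t : sa A t%:C%:A.
Proof. by apply: saZ; exact: star1. Qed.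

Lemma sa_comm_mul a b : sa A a -> sa A b -> a * b = b * a -> sa A (a * b).
Proof. by rewrite /sa /= star_mul => -> -> ->. Qed.

Lemma sa_star_mul a : sa A (star a * a).
Proof. by rewrite /sa /= star_mul starK. Qed.

Lemma rnorm_sa_sqr a : sa A a -> rnorm (a * a) = rnorm a ^+ 2.
Proof. by move=> sa_a; rewrite -{1}[a]sa_a rnorm_star_mul. Qed.

Lemma sa_limit (x : A) :
  (forall d : R, 0 < d -> exists2 y, sa A y & rnorm (x - y) <= d) -> sa A x.
Proof.
move=> xy; apply/eqP; rewrite -subr_eq0; apply/eqP.
apply: (@rnorm_small _ _ _ 2) => d d0.
have [y sy xyd] := xy d d0.
rewrite -(subrKA y) (le_trans (rnormD _ _)) // mulr_natl mulr2n lerD //.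
  by rewrite -{1}sy -starB rnorm_star.
by rewrite rnorm_distC.
Qed.

End CStarNorm.

Section Bicommutant.
Variables (R : realType) (A : cstarType R).
Implicit Types (a b c x : A) (t : R).

(** The bicommutant of [a] stands in for the closed algebra generated by [a]: it
    is stable under the same operations and limits, and any two of its elements
    commute. *)
Definition bicomm a x := forall c, c * a = a * c -> c * x = x * c.

Lemma scalar_comm t a : t%:C%:A * a = a * t%:C%:A.
Proof. by rewrite -scalerAl -scalerAr mul1r mulr1. Qed.

Lemma mul_scalar t a : t%:C%:A * a = t%:C *: a.
Proof. by rewrite -scalerAl mul1r. Qed.

Lemma scalarM t u : t%:C%:A * u%:C%:A = (t * u)%:C%:A :> A.
Proof. by rewrite mul_scalar scalerA -rmorphM. Qed.

Lemma commB a b c : c * a = a * c -> c * b = b * c -> c * (a - b) = (a - b) * c.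
Proof. by move=> ca cb; rewrite mulrBr mulrBl ca cb. Qed.

Lemma commD a b c : c * a = a * c -> c * b = b * c -> c * (a + b) = (a + b) * c.
Proof. by move=> ca cb; rewrite mulrDr mulrDl ca cb. Qed.

Lemma commM a b c : c * a = a * c -> c * b = b * c -> c * (a * b) = (a * b) * c.
Proof. by move=> ca cb; rewrite mulrA ca -mulrA cb mulrA. Qed.

Lemma commZ t a c : c * a = a * c -> c * (t%:C *: a) = t%:C *: a * c.
Proof. by move=> ca; rewrite -scalerAr -scalerAl ca. Qed.

Lemma comm_limit c x :
  (forall d : R, 0 < d -> exists2 y, c * y = y * c & rnorm (x - y) <= d) ->
  c * x = x * c.
Proof.
move=> xy; apply/eqP; rewrite -subr_eq0; apply/eqP.
apply: (@rnorm_small _ _ _ (rnorm c + rnorm c)) => d d0.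
have [y cy xyd] := xy d d0.
have -> : c * x - x * c = c * (x - y) - (x - y) * c.
  by rewrite mulrBr mulrBl cy opprB addrA subrK.
rewrite (le_trans (rnormB _ _)) // [leRHS]mulrDl.
rewrite lerD // (le_trans (rnormM _ _)) //.
  by rewrite ler_wpM2l // rnorm_ge0.
by rewrite mulrC ler_wpM2l // rnorm_ge0.
Qed.

End Bicommutant.

(** * Square roots and the cone of positive elements *)

Section SquareRootNearOne.
Variables (R : realType) (A : cstarType R) (a : A).
Hypothesis (sa_a : sa A a) (a1 : rnorm a < 1).
Let r := rnorm a.
Let f (x : A) : A := (2^-1)%:C *: (a + x * x).
Let u n := iter n f 0.

Let r0 : 0 <= r. Proof. exact: rnorm_ge0. Qed.

Let r1 : r < 1. Proof. exact: a1. Qed.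

Let norm_half (x : A) : rnorm ((2^-1 : R)%:C *: x) = 2^-1 * rnorm x.
Proof. by rewrite rnormZ ger0_norm // invr_ge0. Qed.

Let u_norm n : rnorm (u n) <= r.
Proof.
elim: n => [|n IH]; first by rewrite rnorm0.
rewrite /u iterS norm_half -/(u n).
have := rnormD a (u n * u n); have := rnormM (u n) (u n).
have := rnorm_ge0 (u n); rewrite -/r; move: IH (rnorm_ge0 (a + u n * u n)).
by move: (rnorm (u n)) (rnorm (u n * u n)) (rnorm (a + u n * u n)) => p q s;
  move: r r0 r1 => ? ? ?; nra.
Qed.

Let f_lip x y : rnorm x <= r -> rnorm y <= r ->
  rnorm (f x - f y) <= r * rnorm (x - y).
Proof.
move=> xr yr; rewrite /f -scalerBr norm_half.
have -> : a + x * x - (a + y * y) = x * (x - y) + (x - y) * y.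
  by rewrite mulrBr mulrBl addrA subrK opprD addrACA subrr add0r.
have := rnormD (x * (x - y)) ((x - y) * y).
have := rnormM x (x - y); have := rnormM (x - y) y.
move: (rnorm (x * (x - y))) (rnorm ((x - y) * y)) => p q.
move: (rnorm (x * (x - y) + (x - y) * y)) => s.
have := rnorm_ge0 (x - y); move: (rnorm (x - y)) xr yr => w.
have := rnorm_ge0 x; have := rnorm_ge0 y.
by move: (rnorm x) (rnorm y) r r0 => v z r' r'0 *; nra.
Qed.

Let u_sa n : sa A (u n).
Proof.
elim: n => [|n IH]; first exact: star0.
by rewrite /u iterS; apply: saZ; apply: saD => //; apply: sa_comm_mul.
Qed.

Let u_comm n : bicomm a (u n).
Proof.
elim: n => [|n IH] c ca; first by rewrite mulr0 mul0r.
rewrite /u iterS; apply: commZ; apply: commD => //.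
by apply: commM; apply: IH.
Qed.

(** The map [x |-> (a + x ^+ 2) / 2] is a contraction of the ball of radius
    [rnorm a], and its fixed point [x] satisfies [(1 - x) ^+ 2 = 1 - a]. *)
Lemma sqrt_near_one : exists x : A,
  [/\ sa A x, bicomm a x, rnorm x <= rnorm a & (1 - x) * (1 - x) = 1 - a].
Proof.
have u_cauchy n m : rnorm (u (n + m)%N - u n) <= r ^+ n * r.
  elim: n => [|n IH]; first by rewrite subr0 expr0 mul1r u_norm.
  rewrite addSn /u !iterS (le_trans (f_lip (u_norm _) (u_norm _))) //.
  by rewrite exprS -mulrA ler_wpM2l.
have e0 (d : R) : 0 < d -> exists n, r ^+ n * r < d.
  move=> d0; have r_lt1 : `|r| < 1 by rewrite ger0_norm.
  have /cvgrPdist_lt/(_ _ d0)[N _ NP] := cvg_expr r_lt1.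
  exists N; have /= := NP N (leqnn N).
  rewrite sub0r normrN ger0_norm ?exprn_ge0 // => /(le_lt_trans _); apply.
  by rewrite ler_piMr ?exprn_ge0 // ltW.
have [x xu] : exists x, forall n, rnorm (x - u n) <= r ^+ n * r.
  apply: cauchy_limit => // n m nm.
  by rewrite -(subnKC nm); apply: u_cauchy.
have xuE (d : R) : 0 < d -> exists n, rnorm (x - u n) <= d.
  by move=> /e0[n nd]; exists n; apply: le_trans (xu n) (ltW nd).
have x_norm : rnorm x <= r.
  apply: ler_eps => d /xuE[n nd].
  by rewrite -(subrK (u n) x) addrC (le_trans (rnormD _ _)) // lerD.
have x_fix : x - f x = 0.
  apply: (@rnorm_small _ _ _ 2) => d /e0[n nd].
  rewrite (le_trans (rnorm_triangle (u n.+1) _ _)) // mulr_natl mulr2n lerD //.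
    rewrite (le_trans (xu _)) // (le_trans _ (ltW nd)) // exprS -mulrA.
    by rewrite ler_piMl ?mulr_ge0 ?exprn_ge0 // ltW.
  rewrite /u iterS (le_trans (f_lip (u_norm _) x_norm)) // rnorm_distC.
  rewrite (le_trans _ (ltW nd)) // (le_trans _ (xu n)) //.
  by rewrite ler_piMl ?rnorm_ge0 // ltW.
exists x; split => //.
- by apply: sa_limit => d /xuE[n nd]; exists (u n).
- move=> c ca; apply: comm_limit => d /xuE[n nd]; exists (u n) => //.
  exact: u_comm.
have x2 : x + x = a + x * x.
  have /eqP := x_fix; rewrite subr_eq0 => /eqP xf.
  rewrite {1 2}xf /f -scalerDl -rmorphD /= -[2^-1]mul1r -splitr.
  exact: scale1r.
rewrite mulrBr mulr1 mulrBl mul1r opprB -addrA; congr (_ + _).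
by rewrite addrCA -opprD x2 opprD addrCA subrr addr0.
Qed.

End SquareRootNearOne.

Section PositiveCone.
Variables (R : realType) (A : cstarType R).
Implicit Types (a b c p q r s x y z : A) (t u d : R).

(** For a self-adjoint element, the inequality says that the spectrum lies in the
    interval from [0] to [2 t]. This form of positivity is visibly stable under
    sums, and refers to the norm only. *)
Definition cpos a := sa A a /\ exists t, rnorm (t%:C%:A - a) <= t.

Lemma scalerRA t u a : t%:C *: (u%:C *: a) = (t * u)%:C *: a.
Proof. by rewrite scalerA -rmorphM. Qed.

Lemma mul_scaleR t u a b : (t%:C *: a) * (u%:C *: b) = (t * u)%:C *: (a * b).
Proof. by rewrite -scalerAl -scalerAr scalerRA. Qed.

Lemma cpos_sa a : cpos a -> sa A a.
Proof. by case. Qed.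

Lemma cpos_sub_scalar a t : sa A a -> rnorm a <= t -> cpos (t%:C%:A - a).
Proof.
by move=> sa_a at_; split; [exact/saB/sa_a/sa_scalar|exists t; rewrite subKr].
Qed.

Lemma cpos_add_scalar a t : sa A a -> rnorm a <= t -> cpos (t%:C%:A + a).
Proof.
by move=> sa_a at_; rewrite -[a]opprK; apply: cpos_sub_scalar;
  rewrite ?rnormN //; exact: saN.
Qed.

Lemma cposD a b : cpos a -> cpos b -> cpos (a + b).
Proof.
move=> [sa_a [t at_]] [sb [u bu]]; split; first exact: saD.
exists (t + u); rewrite rmorphD scalerDl /= opprD addrACA.
by rewrite (le_trans (rnormD _ _)) // lerD.
Qed.

Lemma cposZ a t : 0 <= t -> cpos a -> cpos (t%:C *: a).
Proof.
move=> t0 [sa_a [u au]]; split; first exact: saZ.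
exists (t * u); rewrite -scalerRA -scalerBr rnormZ ger0_norm //.
by rewrite ler_wpM2l.
Qed.

Lemma cpos_scalar t : 0 <= t -> cpos t%:C%:A.
Proof.
by move=> t0; split; [exact: sa_scalar|exists t; rewrite subrr rnorm0].
Qed.

(** A positive element has a positive square root up to a positive scalar; the
    scalar brings the element into the range of [sqrt_near_one]. *)
Lemma cpos_sqrt_shift a d : cpos a -> 0 < d ->
  exists s, [/\ cpos s, bicomm a s & s * s = a + d%:C%:A].
Proof.
move=> [sa_a [t at_]] d0; have t0 : 0 <= t := le_trans (rnorm_ge0 _) at_.
have T0 : 0 < t + d by rewrite ltr_wpDl.
pose b := ((t + d)^-1)%:C *: (t%:C%:A - a).
have sb : sa A b by apply: saZ; apply: saB => //; exact: sa_scalar.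
have b1 : rnorm b < 1.
  rewrite rnormZ ger0_norm ?invr_ge0 ?ltW // mulrC ltr_pdivrMr // mul1r.
  by rewrite (le_lt_trans at_) // ltrDl.
have [x [sx xb xn x2]] := sqrt_near_one sb b1.
pose m := Num.sqrt (t + d).
have m0 : 0 <= m := sqrtr_ge0 _.
have mm : m * m = t + d by rewrite -expr2 sqr_sqrtr // ltW.
exists (m%:C *: (1 - x)); split.
- split; first by apply: saZ; apply: saB => //; exact: star1.
  exists m; rewrite -scalerBr subKr rnormZ ger0_norm // ler_piMr //.
  exact: ltW (le_lt_trans xn b1).
- move=> c ca; apply: commZ; apply: commB; first by rewrite mulr1 mul1r.
  by apply: xb; apply: commZ; apply: commB => //; rewrite scalar_comm.
- rewrite mul_scaleR mm x2 scalerBr scalerRA divff ?gt_eqF // scale1r.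
  by rewrite opprB addrCA rmorphD scalerDl /= addrAC subrr add0r.
Qed.

(** [s + 'i r] is normal, hence its norm, which dominates that of its real part
    [s], is the square root of that of [s ^+ 2 + r ^+ 2]. *)
Lemma sum_sqr_norm s r t : sa A s -> sa A r -> s * r = r * s -> 0 <= t ->
  s * s + r * r = t%:C%:A -> rnorm s ^+ 2 <= t.
Proof.
move=> ss sr comm t0 sum; pose x := s + 'i%C *: r.
have xs : star x = s - 'i%C *: r.
  have iC : ('i%C)^*%C = - 'i%C :> R[i].
    by apply/eqP; rewrite eq_complex /= oppr0 !eqxx.
  by rewrite /x starD starZ ss sr iC scaleNr.
have xx : star x * x = t%:C%:A.
  rewrite xs mulrBl !mulrDr -!(scalerAl, scalerAr) comm addrKA.
  by rewrite scalerA -['i%C * _]expr2 sqr_i scaleN1r opprK.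
have xn : rnorm x ^+ 2 = t by rewrite -rnorm_star_mul xx rnorm_scalar ger0_norm.
have s2 : s = (2^-1)%:C *: (x + star x).
  rewrite xs /x addrCA addrK -{2 3}[s]scale1r -scalerDl.
  by rewrite -(rmorphD (real_complex R) 1 1) scalerRA mulVf ?pnatr_eq0 ?scale1r.
rewrite -xn lerXn2r ?nnegrE ?rnorm_ge0 //.
rewrite {1}s2 rnormZ ger0_norm ?invr_ge0 // ler_pdivrMl //.
by rewrite mulr_natl mulr2n (le_trans (rnormD _ _)) // rnorm_star.
Qed.

(** The square roots of [a + d] and [t - a + d] commute, because each lies in the
    bicommutant of [a]; hence [sum_sqr_norm] bounds the norm of [a + d]. *)
Lemma cpos_norm_le a t : 0 <= t -> cpos a -> cpos (t%:C%:A - a) -> rnorm a <= t.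
Proof.
move=> t0 pa pt; apply: ler_eps => e e0.
have d0 : 0 < e / 3 by rewrite divr_gt0.
have [s [ps sa_s s2]] := cpos_sqrt_shift pa d0.
have [r [pr rt r2]] := cpos_sqrt_shift pt d0.
have sr : s * r = r * s.
  apply: rt; apply: commB; first by rewrite scalar_comm.
  by rewrite (sa_s a).
have sum : s * s + r * r = (t + 2 * (e / 3))%:C%:A.
  rewrite s2 r2 addrACA [a + _]addrC subrK mulr_natl mulr2n.
  by rewrite !rmorphD !scalerDl.
have n2 := sum_sqr_norm (cpos_sa ps) (cpos_sa pr) sr _ sum.
have {}n2 : rnorm s ^+ 2 <= t + 2 * (e / 3) by apply: n2; lra.
rewrite -(addrK ((e / 3)%:C%:A) a) (le_trans (rnormB _ _)) // -s2.
rewrite rnorm_sa_sqr ?rnorm_scalar ?ger0_norm ?(ltW d0) //; last exact: cpos_sa.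
by move: (rnorm s ^+ 2) n2 => w; lra.
Qed.

(** As [t - a] is positive by definition and [t - (t - a)] is [a], this is an
    instance of [cpos_norm_le]. It makes the choice of the scalar immaterial in the
    definition of positivity. *)
Lemma cpos_norm_sub a t : cpos a -> rnorm a <= t -> rnorm (t%:C%:A - a) <= t.
Proof.
move=> pa at_; apply: cpos_norm_le; first exact: le_trans (rnorm_ge0 _) at_.
  by apply: cpos_sub_scalar at_; exact: cpos_sa.
by rewrite subKr.
Qed.

Lemma cpos_closed a :
  (forall d, 0 < d -> exists2 b, cpos b & rnorm (a - b) <= d) -> cpos a.
Proof.
move=> ab; split.
  by apply: sa_limit => d /ab[b [sb _]]; exists b.
exists (rnorm a + 1); apply: ler_eps => e e0.
have d0 : 0 < Num.min e 1 by rewrite lt_min e0 /=.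
have [b pb] := ab _ d0; rewrite le_min => /andP[be b1].
rewrite (le_trans (rnorm_triangle b _ _)) // lerD //; last first.
  by rewrite rnorm_distC.
apply: cpos_norm_sub => //; rewrite -(subKr a b).
by rewrite (le_trans (rnormB _ _)) // lerD.
Qed.

Lemma cpos_norm_mono a b : cpos a -> cpos (b - a) -> rnorm a <= rnorm b.
Proof.
move=> pa pba; apply: cpos_norm_le => //; first exact: rnorm_ge0.
rewrite -(subrKA b); apply: cposD => //; apply: cpos_sub_scalar => //.
by rewrite -(subrK a b); apply: saD; exact: cpos_sa.
Qed.

(** Once [s ^+ 2] is scaled into the unit ball by [t], the difference
    [t - s ^+ 2] is the square of an element commuting with [s]. *)
Lemma cpos_sqr s : sa A s -> cpos (s * s).
Proof.
move=> ss; pose t := rnorm (s * s) + 1.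
have t0 : 0 < t by rewrite ltr_wpDl ?rnorm_ge0.
pose b := (t^-1)%:C *: (s * s).
have sss : sa A (s * s) by exact: sa_comm_mul.
have b1 : rnorm b < 1.
  rewrite rnormZ ger0_norm ?invr_ge0 ?ltW // mulrC ltr_pdivrMr // mul1r.
  by rewrite ltrDl.
have [x [sx xb xn x2]] := sqrt_near_one (saZ _ sss) b1.
pose m := Num.sqrt t.
have mm : m * m = t by rewrite -expr2 sqr_sqrtr // ltW.
pose r := m%:C *: (1 - x).
have sr : sa A r by apply: saZ; apply: saB => //; exact: star1.
have rr : r * r = t%:C%:A - s * s.
  by rewrite mul_scaleR mm x2 scalerBr scalerRA divff ?gt_eqF // scale1r.
have comm : r * s = s * r.
  apply/esym/commZ/commB; first by rewrite mulr1 mul1r.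
  by apply: xb; apply: commZ; exact: commM.
split=> //; exists t; rewrite -rr rnorm_sa_sqr //.
by apply: sum_sqr_norm sr ss comm (ltW t0) _; rewrite rr subrK.
Qed.

(** Up to a small scalar, both factors are squares of commuting self-adjoint
    elements, and so is the product. *)
Lemma cposM a b : cpos a -> cpos b -> a * b = b * a -> cpos (a * b).
Proof.
move=> pa pb ab; apply: cpos_closed => e e0.
(* [(a + d) (b + d)] differs from [a b] by [d (a + b + d)], which has norm at
   most [d K] for [d <= 1]. *)
pose K := rnorm a + rnorm b + 1.
have K0 : 0 < K by rewrite ltr_wpDl ?addr_ge0 ?rnorm_ge0.
pose d := Num.min 1 (e / K).
have d0 : 0 < d by rewrite lt_min ltr01 divr_gt0.
have d1 : d <= 1 by rewrite ge_min lexx.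
have dK : d * K <= e by rewrite -ler_pdivlMr // ge_min lexx orbT.
have [s [/cpos_sa ss sa_s s2]] := cpos_sqrt_shift pa d0.
have [r [/cpos_sa sr rb r2]] := cpos_sqrt_shift pb d0.
have sr_comm : s * r = r * s.
  by apply: rb; apply/esym/sa_s.
have srsr : (s * r) * (s * r) = (a + d%:C%:A) * (b + d%:C%:A).
  by rewrite -s2 -r2 -!mulrA; congr (_ * _); rewrite mulrA -sr_comm mulrA.
exists ((s * r) * (s * r)); first exact/cpos_sqr/sa_comm_mul.
rewrite srsr mulrDr mulrDl -addrA opprD addNKr rnormN mulrDl -(scalar_comm d a).
rewrite scalarM !mul_scalar.
rewrite (le_trans (rnormD _ _)) // (le_trans (lerD (lexx _) (rnormD _ _))) //.
rewrite !rnormZ rnorm1 mulr1 !ger0_norm ?mulr_ge0 ?(ltW d0) //.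
rewrite (le_trans _ dK) // /K !mulrDr mulr1 addrA.
rewrite [X in X + _ <= _]addrC lerD //.
by rewrite ler_piMr // ltW.
Qed.

End PositiveCone.

Section CommutingPair.
Variables (R : realType) (A : cstarType R).
(** Evaluation of bivariate polynomials at a commuting pair. It reduces the
    identities between commuting elements to identities between polynomials. *)
Lemma commuting_eval (p q : A) : p * q = q * p ->
  exists ev : {rmorphism {poly {poly R[i]}} -> A},
    [/\ ev 'X%:P = p, ev 'X = q & forall c, ev c%:P%:P = c%:A].
Proof.
move=> pq.
have comm : commr_rmorph (horner_alg p) q.
  move=> f; elim/poly_ind: f => [|f c IH].
    by rewrite rmorph0; exact: commr0.
  rewrite rmorphD rmorphM /= horner_algX horner_algC.
  apply: commrD; first by apply: commrM.
  by rewrite /GRing.comm -scalerAl -scalerAr mul1r mulr1.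
exists (horner_morph comm); split.
- by rewrite /= horner_morphC /= horner_algX.
- by rewrite /= horner_morphX.
- by move=> c; rewrite /= horner_morphC /= horner_algC.
Qed.

End CommutingPair.

Section SquareRoot.
Variables (R : realType) (A : cstarType R).
Implicit Types (a b c p q r s x y z : A) (t u d : R).

(** With [d = p - q] and [e = p + q], the difference of [e ^+ 2] and [d ^+ 2] is
    [4 p q], which is positive, so that [d ^+ 4 <= (d e) ^+ 2]. *)
Lemma cpos_dist_sqr p q : cpos p -> cpos q -> p * q = q * p ->
  rnorm (p - q) ^+ 2 <= rnorm (p * p - q * q).
Proof.
move=> pp pq comm; pose d := p - q; pose e := p + q.
have sp := cpos_sa pp; have sq := cpos_sa pq.
have [ev [evp evq evC]] := commuting_eval comm.
have sd : sa A d by exact: saB.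
have dd : sa A (d * d) by exact: sa_comm_mul.
have de : d * e = p * p - q * q.
  by rewrite /d /e -evp -evq -!(rmorphD, rmorphB, rmorphM); congr (ev _); ring.
have dede : d * e * (d * e) - d * d * (d * d) = 4%:C *: (d * d * (p * q)).
  rewrite -mul_scalar -evC /d /e -evp -evq -!(rmorphD, rmorphB, rmorphM).
  by congr (ev _); ring.
have ddpq : d * d * (p * q) = p * q * (d * d).
  rewrite /d -evp -evq -!(rmorphD, rmorphB, rmorphM).
  by congr (ev _); ring.
rewrite -de -ler_sqr ?nnegrE ?exprn_ge0 ?rnorm_ge0 //.
have sde : sa A (d * e).
  by rewrite de; apply: saB; apply: sa_comm_mul.
rewrite -rnorm_sa_sqr // -rnorm_sa_sqr // -rnorm_sa_sqr //.
apply: cpos_norm_mono; first exact: cpos_sqr.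
rewrite dede; apply: cposZ => //; apply: cposM => //; first exact: cpos_sqr.
exact: cposM.
Qed.

(** The square roots of [a + e n ^+ 2] form a Cauchy sequence when [e n] tends to
    [0], by [cpos_dist_sqr]. *)
Lemma cpos_sqrt a : cpos a ->
  exists s, [/\ cpos s, bicomm a s & s * s = a].
Proof.
move=> pa; pose e n : R := n.+1%:R^-1.
have e_gt0 n : 0 < e n by rewrite invr_gt0 ltr0n.
have e_le n m : (n <= m)%N -> e m <= e n.
  by move=> nm; rewrite lef_pV2 ?posrE ?ltr0n // ler_nat.
have /choice[s sP] : forall n, exists s,
    [/\ cpos s, bicomm a s & s * s = a + (e n ^+ 2)%:C%:A].
  by move=> n; apply: cpos_sqrt_shift => //; rewrite exprn_gt0.
have s_cauchy n m : (n <= m)%N -> rnorm (s m - s n) <= e n.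
  move=> nm; have [pm bm sm] := sP m; have [pn bn sn] := sP n.
  rewrite -ler_sqr ?nnegrE ?rnorm_ge0 ?(ltW (e_gt0 _)) //.
  rewrite (le_trans (cpos_dist_sqr pm pn _)) //.
    by apply: bn; apply/esym/bm.
  rewrite sm sn opprD addrACA subrr add0r -scalerBl -rmorphB rnorm_scalar.
  rewrite distrC ger0_norm; first by rewrite gerBl exprn_ge0 // ltW.
  by rewrite subr_ge0 lerXn2r ?nnegrE ?(ltW (e_gt0 _)) // e_le.
have e_small d : 0 < d -> exists n, e n < d.
  move=> d0; have [N _ NP] := near_infty_natSinv_lt (PosNum d0).
  by exists N; apply: (NP N (leqnn N)).
have [x xs] := cauchy_limit e_small s_cauchy.
have xsE d : 0 < d -> exists n, rnorm (x - s n) <= d.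
  by move=> /e_small[n nd]; exists n; apply: le_trans (xs n) (ltW nd).
exists x; split.
- by apply: cpos_closed => d /xsE[n nd]; exists (s n) => //; case: (sP n).
- move=> c ca; apply: comm_limit => d /xsE[n nd]; exists (s n) => //.
  by have [_ + _] := sP n; apply.
apply/eqP; rewrite -subr_eq0; apply/eqP.
apply: (@rnorm_small _ _ _ (2 * rnorm x + 2)) => d d0.
have /e_small[n] : 0 < Num.min d 1 by rewrite lt_min d0 /=.
rewrite lt_min => /andP[nd n1].
have [_ _ sn] := sP n.
have -> : x * x - a = x * (x - s n) + (x - s n) * s n + (e n ^+ 2)%:C%:A.
  by rewrite mulrBr mulrBl sn addrA subrK opprD addrA subrK.
have := rnormD (x * (x - s n) + (x - s n) * s n) ((e n ^+ 2)%:C%:A).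
have := rnormD (x * (x - s n)) ((x - s n) * s n).
have := rnormM x (x - s n); have := rnormM (x - s n) (s n).
have := rnormD x (s n - x); rewrite addrCA subrr addr0 rnorm_distC.
have := xs n; have := rnorm_ge0 (x - s n); have := rnorm_ge0 x.
rewrite rnorm_scalar ger0_norm ?exprn_ge0 ?(ltW (e_gt0 n)) //.
move: (rnorm (x * (x - s n))) (rnorm ((x - s n) * s n)) => v1 v2.
move: (rnorm (x * (x - s n) + (x - s n) * s n)) => v3.
move: (rnorm (_ + _)) (rnorm (x - s n)) (rnorm x) (rnorm (s n)) => v4 v5 v6 v7.
by move: (e n) (e_gt0 n) nd n1 => w *; nra.
Qed.

End SquareRoot.

(** * Elements of the form [x^* x] are positive *)

Section Fukamiya.
Variables (R : realType) (A : cstarType R).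
Implicit Types (a b c p q r s x y z : A) (t u d : R).

Lemma conjC_i : ('i%C)^*%C = - 'i%C :> R[i].
Proof. by apply/eqP; rewrite eq_complex /= oppr0 !eqxx. Qed.

Lemma sa_re_part z : sa A (re_part z).
Proof.
have C2 : ((2 : R[i])^-1)^*%C = 2^-1 by rewrite rmorphV ?unitfE // rmorph_nat.
by rewrite /sa /= /re_part starZ starD starK C2 addrC.
Qed.

Lemma imaginary_neq0 : 'i%C != 0 :> R[i].
Proof. by rewrite eq_complex /= oner_eq0 andbF. Qed.

Lemma sa_im_part z : sa A (im_part z).
Proof.
have C2 : ((2 * 'i%C : R[i])^-1)^*%C = - (2 * 'i%C)^-1.
  rewrite rmorphV ?unitfE ?mulf_neq0 ?imaginary_neq0 //.
  by rewrite -invrN -mulrN -conjC_i rmorphM rmorph_nat.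
by rewrite /sa /= /im_part starZ starB starK C2 scaleNr -scalerN opprB.
Qed.

Lemma re_imE z : z = re_part z + 'i%C *: im_part z.
Proof.
rewrite /re_part /im_part scalerA invfM mulrCA divff ?imaginary_neq0 // mulr1.
rewrite -scalerDr addrACA subrr addr0 -{2 3}[z]scale1r -scalerDl scalerA.
by rewrite mulVf ?scale1r // pnatr_eq0.
Qed.

(** For [z = a + i b], the sum is [2 (a ^+ 2 + b ^+ 2)]. *)
Lemma cpos_mul_star_add z : cpos (z * star z + star z * z).
Proof.
rewrite [z]re_imE; have := sa_re_part z; have := sa_im_part z.
move: (re_part z) (im_part z) => a b sb sa_a.
rewrite starD starZ sa_a sb conjC_i scaleNr.
rewrite !mulrDl !mulrDr !mulrN !mulNr -!(scalerAl, scalerAr) !scalerA.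
rewrite -['i%C * _]expr2 sqr_i !scaleN1r !opprK.
rewrite addrACA [X in cpos (X + _)]addrACA [X in cpos (_ + X)]addrACA.
rewrite addNr addr0 subrr add0r addrACA.
by apply: cposD; apply: cposD; exact: cpos_sqr.
Qed.

(** Both [r = - z^* z] and [q = z z^*] are positive, although their spectra are
    opposite up to [0]. Instead of spectra, the proof compares the norms
    of [w w^*] and [w^* w] for [w = (l - q) z = z (l + r)], where [l] is the
    common norm of [q] and [r]: as [0 <= q <= l], that of
    [w w^* = (l - q) q (l - q)] is at most [l ^+ 3], whereas that of
    [- w^* w = (l + r) r (l + r)] is at least [l ^+ 2 r + 2 l r ^+ 2]. *)
Lemma cpos_opp_star_mul_eq0 z : cpos (- (star z * z)) -> z = 0.
Proof.
pose r := - (star z * z); pose q := z * star z; rewrite -/r => pr.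
pose l := rnorm z ^+ 2; have l0 : 0 <= l by rewrite exprn_ge0 ?rnorm_ge0.
have lE : rnorm z ^+ 2 = l by [].
have rn : rnorm r = l by rewrite rnormN rnorm_star_mul.
have qn : rnorm q = l by rewrite rnorm_mul_star.
clearbody l.
have pq : cpos q.
  have -> : q = (z * star z + star z * z) + r by rewrite addrK.
  by apply: cposD => //; exact: cpos_mul_star_add.
have lq : rnorm (l%:C%:A - q) <= l by apply: cpos_norm_sub; rewrite ?qn.
have sq : sa A (l%:C%:A - q) by apply: saB (cpos_sa pq); exact: sa_scalar.
have sr : sa A (l%:C%:A + r) by apply: saD (cpos_sa pr); exact: sa_scalar.
pose w := (l%:C%:A - q) * z; pose g := (l%:C%:A + r) * r * (l%:C%:A + r).
have wE : w = z * (l%:C%:A + r).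
  by rewrite /w mulrBl mulrDr scalar_comm /r /q mulrN !mulrA.
have gE : star w * w = - g.
  rewrite wE star_mul sr -mulrA [star z * _]mulrA /g /r.
  by rewrite !(mulrN, mulNr) opprK mulrA.
have gn : rnorm g <= l ^+ 3.
  rewrite -rnormN -gE rnorm_star_mul -rnorm_mul_star /w star_mul sq.
  rewrite -mulrA (le_trans (rnormM _ _)) // exprS ler_pM ?rnorm_ge0 //.
  rewrite mulrA -/q (le_trans (rnormM _ _)) // expr2.
  by rewrite ler_pM ?rnorm_ge0 ?qn.
have [ev [evr _ evC]] := commuting_eval (erefl (r * r)).
have sg : sa A g.
  have -> : g = (l%:C%:A + r) * ((l%:C%:A + r) * r).
    rewrite /g -!evC -evr -!(rmorphD, rmorphB, rmorphM).
    by congr (ev _); ring.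
  apply: sa_comm_mul => //; first apply: sa_comm_mul => //.
  - exact: cpos_sa.
  - rewrite -!evC -evr -!(rmorphD, rmorphB, rmorphM); congr (ev _); ring.
  - rewrite -!evC -evr -!(rmorphD, rmorphB, rmorphM); congr (ev _); ring.
(* From [l ^+ 3 - g >= 0], discarding [r ^+ 3] and using [(r - l) ^+ 2 >= 0] to
   bound [r ^+ 2] from below by [2 l r - l ^+ 2]. *)
have bound : cpos ((3 * l ^+ 3)%:C%:A - (5 * l ^+ 2)%:C *: r).
  have -> : (3 * l ^+ 3)%:C%:A - (5 * l ^+ 2)%:C *: r =
      ((l ^+ 3)%:C%:A - g) + r * (r * r) +
      (2 * l)%:C *: ((r - l%:C%:A) * (r - l%:C%:A)).
    rewrite /g -(mul_scalar (2 * l)) -(mul_scalar (5 * l ^+ 2)).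
    rewrite -!evC -evr -!(rmorphD, rmorphB, rmorphM).
    by congr (ev _); ring.
  apply: cposD; first apply: cposD.
  - exact: cpos_sub_scalar.
  - apply: cposM => //; first exact/cpos_sqr/cpos_sa.
    by rewrite mulrA.
  - apply: cposZ; first by rewrite mulr_ge0.
    by apply/cpos_sqr/saB; [exact: cpos_sa|exact: sa_scalar].
have l_eq0 : l = 0.
  apply/eqP; apply: contraT => ln0; have {}ln0 : 0 < l by rewrite lt0r ln0.
  have l5 : 0 < 5 * l ^+ 2 by rewrite mulr_gt0 ?exprn_gt0.
  have : rnorm r <= 3 / 5 * l.
    apply: cpos_norm_le => //; first by lra.
    have l5V : 0 <= (5 * l ^+ 2)^-1 by rewrite invr_ge0 ltW.
    have := cposZ l5V bound.
    rewrite scalerBr !scalerRA mulVf ?gt_eqF // scale1r.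
    by congr (cpos (_%:C%:A - _)); field; rewrite ?gt_eqF.
  by rewrite rn; lra.
by apply: rnorm_eq0; apply/eqP; rewrite -(sqrf_eq0 (rnorm z)) lE l_eq0.
Qed.

(** For [y = x^* x], let [h] be the square root of [y ^+ 2], and let [n = h - y]
    be twice the negative part of [y]. As [n y = - h n], the element [z = x n]
    satisfies [- z^* z = h n ^+ 2], which is positive. Hence [z = 0], and so
    [n = 0]. *)
Theorem cpos_star_mul x : cpos (star x * x).
Proof.
pose y := star x * x; have sy : sa A y := sa_star_mul x.
have [h [ph hy h2]] := cpos_sqrt (cpos_sqr sy); have sh := cpos_sa ph.
have yh : y * h = h * y by apply: hy; rewrite mulrA.
pose n := h - y; have sn : sa A n by exact: saB.
have hn : h * n = n * h by apply: commB.
have ny : n * y = - (h * n).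
  by rewrite /n mulrBl mulrBr -h2 opprB.
have zz : star (x * n) * (x * n) = - (h * (n * n)).
  by rewrite star_mul sn -mulrA [star x * _]mulrA -/y mulrA ny mulNr mulrA.
have hnn : h * (n * n) = 0.
  have z0 : x * n = 0.
    apply: cpos_opp_star_mul_eq0; rewrite zz opprK.
    by apply: cposM; [|exact: cpos_sqr|exact: commM].
  by apply/eqP; rewrite -oppr_eq0 -zz z0 mulr0.
have nnn : n * (n * n) = 0.
  rewrite {1}/n mulrBl hnn sub0r; apply/eqP; rewrite oppr_eq0.
  have yn : y * n = n * y by rewrite /n mulrBl mulrBr yh.
  by rewrite mulrA yn ny mulNr -mulrA hnn oppr0.
have n0 : n = 0.
  apply: rnorm_eq0; apply/eqP; rewrite -(sqrf_eq0 (rnorm n)) -rnorm_sa_sqr //.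
  rewrite -(sqrf_eq0 (rnorm (n * n))) -rnorm_sa_sqr; last exact: sa_comm_mul.
  by rewrite -mulrA nnn mulr0 rnorm0.
have yE : y = h by apply/eqP; rewrite eq_sym -subr_eq0 -/n n0.
by rewrite -/y yE.
Qed.

End Fukamiya.

(** * The Hahn-Banach theorem and the existence of states *)

Section HahnBanach.
Variables (R : realType) (V : lmodType R) (p : V -> R).
Hypothesis p_sub : forall x y, p (x + y) <= p x + p y.
Hypothesis p_hom : forall (t : R) x, 0 < t -> p (t *: x) = t * p x.

(** Partial functionals are handled through their graphs, subspaces of [V * R];
    a subspace below [p] is automatically the graph of a function. The empty set
    is admitted because chains may be empty. *)
Let dominated_graph (v0 : V) (c0 : R) (G : set (V * R)) :=
  [/\ forall t x y, G x -> G y -> G (x.1 + t *: y.1, x.2 + t * y.2),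
      forall x, G x -> x.2 <= p x.1 &
      G !=set0 -> G (v0, c0)].

Let dominated_chain v0 c0 (F : set (set (V * R))) :
  F `<=` dominated_graph v0 c0 -> total_on F subset ->
  dominated_graph v0 c0 (\bigcup_(X in F) X).
Proof.
move=> Fdom Ftot; split.
- move=> t x y [X FX Xx] [Y FY Yy].
  have [XY|YX] := Ftot X Y FX FY.
    by exists Y => //; have [+ _ _] := Fdom _ FY; apply=> //; exact: XY.
  by exists X => //; have [+ _ _] := Fdom _ FX; apply=> //; exact: YX.
- by move=> x [X FX Xx]; have [_ + _] := Fdom _ FX; apply.
- move=> [x [X FX Xx]]; exists X => //.
  by have [_ _] := Fdom _ FX; apply; exists x.
Qed.

(** The value [c] at [v] must lie between [a - p (x - v)] and [p (y + v) - b] for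
    all [(x, a)] and [(y, b)] in the graph; the supremum of the former will do. *)
Let dominated_extension v0 c0 G v :
  dominated_graph v0 c0 G -> G !=set0 -> exists c,
    dominated_graph v0 c0
      [set z | exists x t, G x /\ z = (x.1 + t *: v, x.2 + t * c)].
Proof.
move=> [Glin Gp G0] Gne.
have Gscale t x : G x -> G (t *: x.1, t * x.2).
  move=> Gx; have := Glin (t - 1) x x Gx Gx.
  by rewrite -{1}[x.1]scale1r -scalerDl -{1}[x.2]mul1r -mulrDl addrC subrK.
have Gadd x y : G x -> G y -> G (x.1 + y.1, x.2 + y.2).
  by move=> Gx Gy; have := Glin 1 x y Gx Gy; rewrite scale1r mul1r.
pose S := [set x.2 - p (x.1 - v) | x in G].
have S_ub y : G y -> ubound S (p (y.1 + v) - y.2).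
  move=> Gy _ [x Gx <-]; rewrite lerBrDr addrAC lerBlDr.
  rewrite (le_trans (Gp _ (Gadd _ _ Gx Gy))) //= addrC.
  by rewrite (le_trans _ (p_sub _ _)) // addrACA subrr addr0.
have S_sup : has_sup S.
  have [g Gg] := Gne.
  split; first by exists (g.2 - p (g.1 - v)), g.
  by exists (p (g.1 + v) - g.2); exact: S_ub.
exists (sup S).
have c_le y : G y -> sup S <= p (y.1 + v) - y.2.
  by move=> Gy; apply: ge_sup; [case: S_sup|exact: S_ub].
have c_ge x : G x -> x.2 - p (x.1 - v) <= sup S.
  by move=> Gx; apply: ub_le_sup; [case: S_sup|exists x].
split.
- move=> t _ _ [x [a [Gx ->]]] [y [b [Gy ->]]] /=.
  exists (x.1 + t *: y.1, x.2 + t * y.2), (a + t * b); split; first exact: Glin.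
  congr (_, _) => /=; last by ring.
  by rewrite scalerDr scalerDl scalerA addrACA.
- move=> _ [x [t [Gx ->]]] /=.
  have [t0|t0|->] := ltgtP t 0; last by rewrite scale0r mul0r !addr0; exact: Gp.
  + have s0 : 0 < - t by rewrite oppr_gt0.
    have := c_ge _ (Gscale (- t)^-1 x Gx).
    rewrite /= lerBlDr -(ler_pM2l s0) mulrA mulfV ?gt_eqF // mul1r mulrDr.
    rewrite -(p_hom _ s0) scalerBr scalerA mulfV ?gt_eqF // scale1r.
    by rewrite scaleNr opprK mulNr -lerBlDl opprK addrC.
  + have := c_le _ (Gscale t^-1 x Gx).
    rewrite /= lerBrDr -(ler_pM2l t0) mulrDr mulrA mulfV ?gt_eqF // mul1r.
    by rewrite -(p_hom _ t0) scalerDr scalerA mulfV ?gt_eqF // scale1r addrC.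
- move=> _; exists (v0, c0), 0; split; first exact: G0.
  by rewrite scale0r mul0r !addr0.
Qed.

Theorem hahn_banach (v0 : V) (c0 : R) : (forall t, t * c0 <= p (t *: v0)) ->
  exists f : V -> R,
    [/\ forall t x y, f (t *: x + y) = t * f x + f y,
        forall x, f x <= p x & f v0 = c0].
Proof.
move=> c0p.
have [G [Gdom Gmax]] := Zorn_bigcup (@dominated_chain v0 c0).
have line_dom : dominated_graph v0 c0 [set (t *: v0, t * c0) | t in [set: R]].
  split.
  - move=> t _ _ [a _ <-] [b _ <-] /=; exists (a + t * b) => //.
    by rewrite scalerDl scalerA mulrDl mulrA.
  - by move=> _ [t _ <-]; exact: c0p.
  - by move=> _; exists 1; rewrite ?scale1r ?mul1r.
have Gne : G !=set0.
  apply: contrapT => /set0P/negP; rewrite negbK => /eqP G0.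
  apply: Gmax line_dom; rewrite G0; split => // /(_ (1 *: v0, 1 * c0)).
  by apply; exists 1.
have [Glin Gp /(_ Gne) Gv0] := Gdom.
have Gtotal v : exists c, G (v, c).
  apply: contrapT => vG; have [c cdom] := dominated_extension v Gdom Gne.
  apply: Gmax cdom; split.
    move=> x Gx; exists x, 0; split => //.
    by rewrite scale0r mul0r !addr0; case: x Gx.
  have [g Gg] := Gne; move=> /(_ (g.1 + 1 *: v, g.2 + 1 * c)) Gsub.
  have {Gsub} Gv : G (g.1 + 1 *: v, g.2 + 1 * c) by apply: Gsub; exists g, 1.
  apply: vG; exists c; have := Glin (-1) _ _ Gv Gg => /=.
  rewrite scaleN1r mulN1r scale1r mul1r.
  by rewrite addrAC subrr add0r addrAC subrr add0r.
have [f fG] := choice Gtotal.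
have Gfun v c d : G (v, c) -> G (v, d) -> c = d.
  move=> Gc Gd.
  wlog: c d Gc Gd / c < d.
    by move=> wl; have [cd|cd|//] := ltgtP c d; [|apply/esym]; apply: wl.
  move=> cd; have G0 := Glin (-1) _ _ Gd Gc; rewrite /= scaleN1r subrr in G0.
  have G00 t : G (t *: 0, t * (d + -1 * c)).
    have := Glin (t - 1) _ _ G0 G0 => /=.
    by rewrite scaler0 add0r scaler0 -{1}[d + _]mul1r -mulrDl addrC subrK.
  have p0 : p 0 = 0.
    have := p_hom 0 (ltr0Sn R 1); rewrite scaler0; lra.
  have /Gp /= := G00 1; rewrite scaler0 p0; lra.
exists f; split.
- move=> t x y; apply: Gfun (fG _) _; rewrite addrC [X in (_, X)]addrC.
  exact: (Glin t _ _ (fG y) (fG x)).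
- by move=> x; apply: (Gp _ (fG x)).
- exact: Gfun (fG v0) Gv0.
Qed.

End HahnBanach.

Section PositiveFunctionals.
Variables (R : realType) (A : cstarType R).
Implicit Types (a b s x : A) (t : R).

Definition positive_functional (f : A -> R[i]^o) :=
  linear f /\ forall a, 0 <= f (star a * a) :> R[i].

Lemma state_positive phi : states A phi -> positive_functional phi.
Proof. by case. Qed.

Lemma state1 phi : states A phi -> phi 1 = 1.
Proof. by case. Qed.

Lemma rnorm_real t : rnorm (t%:C : R[i]^o) = `|t|.
Proof. by rewrite /rnorm [X in complex.Re X](real_norm t). Qed.

Section Functional.
Variable f : A -> R[i]^o.
Hypothesis pos_f : positive_functional f.

Lemma pfunD a b : f (a + b) = f a + f b.
Proof. by have [lf _] := pos_f; have := lf 1 a b; rewrite !scale1r. Qed.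

Lemma pfun0 : f 0 = 0.
Proof. by apply: (addrI (f 0)); rewrite -pfunD !addr0. Qed.

Lemma pfunZ z a : f (z *: a) = z * f a.
Proof. by have [lf _] := pos_f; have := lf z a 0; rewrite pfun0 !addr0. Qed.

Lemma pfunN a : f (- a) = - f a.
Proof. by rewrite -scaleN1r pfunZ mulN1r. Qed.

Lemma pfunB a b : f (a - b) = f a - f b.
Proof. by rewrite pfunD pfunN. Qed.

Lemma pfun_cpos a : cpos a -> 0 <= f a :> R[i].
Proof.
move=> /cpos_sqrt[s [/cpos_sa ss _ <-]]; rewrite -{1}ss.
by have [_] := pos_f.
Qed.

Lemma pfun1_ge0 : 0 <= f 1 :> R[i].
Proof.
rewrite -[1]scale1r -(rmorph1 (real_complex R)).
exact/pfun_cpos/cpos_scalar.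
Qed.

Lemma pfun1E : f 1 = (complex.Re (f 1))%:C.
Proof. by rewrite RRe_real // ger0_real // pfun1_ge0. Qed.

(** Both [rnorm a - a] and [rnorm a + a] are positive. *)
Lemma pfun_sa a : sa A a -> f a = (complex.Re (f a))%:C /\
  `|complex.Re (f a)| <= complex.Re (f 1) * rnorm a.
Proof.
move=> sa_a.
have pB : 0 <= f ((rnorm a)%:C%:A - a) :> R[i].
  by apply/pfun_cpos/cpos_sub_scalar.
have pD : 0 <= f ((rnorm a)%:C%:A + a) :> R[i].
  by apply/pfun_cpos/cpos_add_scalar.
move: pB pD; rewrite pfunB pfunD pfunZ pfun1E -rmorphM /= mulrC.
case: (f a) => u v; rewrite !lecE /= sub0r oppr_eq0.
move=> /andP[/eqP -> le_u] /andP[_ ge_u].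
by split=> //; rewrite ler_norml; apply/andP; split; lra.
Qed.

Lemma pfun_sa_norm a : sa A a -> rnorm (f a) <= complex.Re (f 1) * rnorm a.
Proof. by move=> /pfun_sa[fE le]; rewrite fE rnorm_real. Qed.

Lemma pfun_re_im a : f a = f (re_part a) + 'i%C * f (im_part a).
Proof. by rewrite -pfunZ -pfunD -re_imE. Qed.

End Functional.

Lemma state_sa_norm phi a : states A phi -> sa A a -> rnorm (phi a) <= rnorm a.
Proof.
by move=> sp sa_a; rewrite (le_trans (pfun_sa_norm (state_positive sp) sa_a)) //
  (state1 sp) mul1r.
Qed.

End PositiveFunctionals.

(** Restriction of scalars from complex to real numbers. *)
Definition realify (V : Type) : Type := V.

Section Realification.
Variables (R : realType) (V : lmodType R[i]).

HB.instance Definition _ := GRing.Zmodule.copy (realify V) V.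

Let scale (t : R) (x : realify V) : realify V := t%:C *: (x : V).

Let scaleA t u x : scale t (scale u x) = scale (t * u) x.
Proof. by rewrite /scale scalerA -rmorphM. Qed.

Let scale1 : left_id 1 scale.
Proof. by move=> x; exact: scale1r. Qed.

Let scaleDr : right_distributive scale +%R.
Proof. by move=> t x y; exact: scalerDr. Qed.

Let scaleDl x : {morph scale^~ x : t u / t + u}.
Proof. by move=> t u; rewrite /scale rmorphD; exact: scalerDl. Qed.

HB.instance Definition _ := GRing.Zmodule_isLmodule.Build R (realify V)
  scaleA scale1 scaleDr scaleDl.

End Realification.

Section StateExistence.
Variables (R : realType) (A : cstarType R).

(** A real functional below the norm and with value [1] at [1] is nonnegative at
    every [a] with [rnorm (t - a) <= t], thus at every [x^* x] by
    [cpos_star_mul]. Composed with the real part and complexified, it becomes a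
    state. *)
Lemma states_nonempty : states A !=set0.
Proof.
pose p (x : realify A) : R := rnorm (x : A).
have [] := @hahn_banach R (realify A) p _ _ (1 : A) 1.
- by move=> x y; exact: rnormD.
- by move=> t x t0; rewrite /p rnormZ gtr0_norm.
- by move=> t; rewrite /p rnormZ rnorm1 !mulr1 ler_norm.
move=> f [f_lin f_le f1].
have fD (x y : A) : f (x + y : A) = f x + f y.
  by have := f_lin 1 x y; rewrite mul1r scale1r.
have f0 : f (0 : A) = 0 by apply: (addrI (f (0 : A))); rewrite -fD !addr0.
have fZ t (x : A) : f (t%:C *: x : A) = t * f x.
  by have := f_lin t x (0 : A); rewrite f0 !addr0.
have f_pos (a : A) : cpos a -> 0 <= f a.
  move=> [_ [t at_]]; have := le_trans (f_le (t%:C%:A - a)) at_.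
  have -> : t%:C%:A - a = t%:C%:A + (-1)%:C *: a by rewrite rmorphN1 scaleN1r.
  by rewrite fD !fZ f1; lra.
pose g (x : A) := f (re_part x).
have reD (x y : A) : re_part (x + y) = re_part x + re_part y.
  by rewrite /re_part starD addrACA scalerDr.
have gD x y : g (x + y) = g x + g y by rewrite /g reD fD.
have reZ t (x : A) : re_part (t%:C *: x) = t%:C *: re_part x.
  by rewrite /re_part starZr -scalerDr !scalerA mulrC.
have gZ t x : g (t%:C *: x) = t * g x by rewrite /g reZ fZ.
have re_sa (x : A) : sa A x -> re_part x = x.
  move=> sx; rewrite /re_part sx -[x in x + x]scale1r -scalerDl scalerA.
  by rewrite mulVf ?scale1r // pnatr_eq0.
have g_sa x : sa A x -> g x = f x by move=> sx; rewrite /g re_sa.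
have g_isa x : sa A x -> g ('i%C *: x) = 0.
  by move=> sx; rewrite /g /re_part starZ sx conjC_i scaleNr subrr scaler0.
pose phi (x : A) : R[i]^o := (g x)%:C - 'i%C * (g ('i%C *: x))%:C.
have phi_sa x : sa A x -> phi x = (f x)%:C.
  by move=> sx; rewrite /phi g_isa // g_sa // mulr0 subr0.
have phiD x y : phi (x + y) = phi x + phi y.
  by rewrite /phi scalerDr !gD !rmorphD /= mulrDr opprD addrACA.
have phiZr t x : phi (t%:C *: x) = t%:C * phi x.
  have e : 'i%C *: (t%:C *: x) = t%:C *: ('i%C *: x) by rewrite !scalerA mulrC.
  by rewrite /phi e !gZ !rmorphM /= mulrBr mulrCA.
have phiZi x : phi ('i%C *: x) = 'i%C * phi x.
  have ii : 'i%C * 'i%C = (-1)%:C :> R[i] by rewrite -expr2 sqr_i rmorphN1.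
  rewrite /phi scalerA ii gZ mulN1r rmorphN mulrN opprK mulrBr mulrA ii.
  by rewrite rmorphN1 mulN1r opprK addrC.
exists phi; split.
- move=> z x y; rewrite phiD; congr (_ + _).
  rewrite [z]complexE scalerDl -scalerA phiD phiZi !phiZr /GRing.scale /=.
  by rewrite mulrDl mulrA.
- move=> a; rewrite phi_sa; last exact: sa_star_mul.
  by rewrite lecR f_pos //; exact: cpos_star_mul.
- by rewrite phi_sa ?f1 //; exact: star1.
Qed.

End StateExistence.

(** * Star-morphisms and Hilbert modules *)

Lemma rnorm_iZ (R : realType) (V : normedModType R[i]) (x : V) :
  rnorm ('i%C *: x) = rnorm x.
Proof.
have i1 : `|'i%C : R[i]| = 1.
  by rewrite normc_def /= expr0n expr1n add0r sqrtr1.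
by rewrite /rnorm normrZ i1 mul1r.
Qed.

Section RealImaginaryParts.
Variables (R : realType) (A : cstarType R).
Implicit Types a b : A.

Lemma re_partB a b : re_part (a - b) = re_part a - re_part b.
Proof. by rewrite /re_part starB -scalerBr opprD addrACA. Qed.

Lemma im_partB a b : im_part (a - b) = im_part a - im_part b.
Proof.
rewrite /im_part starB -scalerBr; congr (_ *: _).
by rewrite !opprB addrACA [RHS]addrACA; congr (_ + _); exact: addrC.
Qed.

Lemma rnorm_re_part a : rnorm (re_part a) <= rnorm a.
Proof.
have -> : re_part a = (2^-1)%:C *: (a + star a).
  by rewrite /re_part fmorphV rmorph_nat.
rewrite rnormZ ger0_norm ?invr_ge0 // ler_pdivrMl // mulr_natl mulr2n.
by rewrite (le_trans (rnormD _ _)) // rnorm_star.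
Qed.

Lemma rnorm_im_part a : rnorm (im_part a) <= rnorm a.
Proof.
have e : rnorm ((2%:C) *: ('i%C *: im_part a)) = rnorm (a - star a).
  rewrite /im_part rmorph_nat !scalerA mulfV ?scale1r //.
  by rewrite mulf_neq0 ?pnatr_eq0 ?imaginary_neq0.
have := rnormB a (star a).
by rewrite -e rnormZ rnorm_iZ rnorm_star ger0_norm //; lra.
Qed.

End RealImaginaryParts.

Section StarMorphisms.
Variables (R : realType) (A B : cstarType R) (theta : A -> B).
Hypothesis mor : star_morphism theta.
Implicit Types a b : A.

Lemma morD a b : theta (a + b) = theta a + theta b.
Proof. by have [lin _ _] := mor; have := lin 1 a b; rewrite !scale1r. Qed.

Lemma mor0 : theta 0 = 0.
Proof. by apply: (addrI (theta 0)); rewrite -morD !addr0. Qed.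

Lemma morZ z a : theta (z *: a) = z *: theta a.
Proof. by have [lin _ _] := mor; have := lin z a 0; rewrite mor0 !addr0. Qed.

Lemma morB a b : theta (a - b) = theta a - theta b.
Proof. by rewrite -scaleN1r morD morZ scaleN1r. Qed.

Lemma morM a b : theta (a * b) = theta a * theta b.
Proof. by have [_ [_ mM] _] := mor. Qed.

Lemma mor1 : theta 1 = 1.
Proof. by have [_ [m1 _] _] := mor. Qed.

Lemma mor_star a : theta (star a) = star (theta a).
Proof. by have [_ _ ms] := mor. Qed.

Lemma mor_sa a : sa A a -> sa B (theta a).
Proof. by rewrite /sa /= => sa_a; rewrite -mor_star sa_a. Qed.

Lemma mor_re a : theta (re_part a) = re_part (theta a).
Proof. by rewrite /re_part morZ morD mor_star. Qed.

Lemma mor_im a : theta (im_part a) = im_part (theta a).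
Proof. by rewrite /im_part morZ morB mor_star. Qed.

Lemma mor_cpos a : cpos a -> cpos (theta a).
Proof.
move=> /cpos_sqrt[s [/cpos_sa ss _ <-]].
by rewrite morM; exact/cpos_sqr/mor_sa.
Qed.

(** For [a] self-adjoint of norm [t], both [t - theta a] and [t + theta a] are
    positive, hence so is their product [t ^+ 2 - theta a ^+ 2]. The C*-identity
    reduces the general case to this one. *)
Lemma mor_norm a : rnorm (theta a) <= rnorm a.
Proof.
have norm_sa c : sa A c -> rnorm (theta c) <= rnorm c.
  move=> sc; set t := rnorm c; have t0 : 0 <= t := rnorm_ge0 _.
  have sb := mor_sa sc; set b := theta c in sb *.
  have mB : cpos (t%:C%:A - b).
    by rewrite -mor1 -morZ -morB; apply: mor_cpos; exact: cpos_sub_scalar.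
  have mD : cpos (t%:C%:A + b).
    by rewrite -mor1 -morZ -morD; apply: mor_cpos; exact: cpos_add_scalar.
  have [ev [evb _ evC]] := commuting_eval (erefl (b * b)).
  have b2 : cpos ((t ^+ 2)%:C%:A - b * b).
    have -> : (t ^+ 2)%:C%:A - b * b = (t%:C%:A - b) * (t%:C%:A + b).
      rewrite -!evC -evb -!(rmorphD, rmorphB, rmorphM).
      by congr (ev _); ring.
    apply: cposM => //.
    by rewrite -!evC -evb -!(rmorphD, rmorphB, rmorphM); congr (ev _); ring.
  rewrite -ler_sqr ?nnegrE ?rnorm_ge0 // -rnorm_sa_sqr //.
  by apply: cpos_norm_le (cpos_sqr sb) b2; rewrite exprn_ge0.
rewrite -ler_sqr ?nnegrE ?rnorm_ge0 // -!rnorm_star_mul -mor_star -morM.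
by apply: norm_sa; exact: sa_star_mul.
Qed.

Lemma state_comp phi : states B phi -> states A (phi \o theta).
Proof.
move=> sp; have pp := state_positive sp; split.
- by move=> z a b /=; rewrite morD morZ (pfunD pp) (pfunZ pp).
- by move=> a /=; rewrite morM mor_star; case: pp.
- by rewrite /= mor1 (state1 sp).
Qed.

End StarMorphisms.

Section HilbertModules.
Variables (R : realType) (A : cstarType R) (M : hilbertModType A).
Implicit Types (w v : M) (a c : A).

Lemma cpos_conj a c : cpos c -> cpos (a * c * star a).
Proof.
move=> /cpos_sqrt[s [/cpos_sa ss _ <-]].
have -> : a * (s * s) * star a = star (s * star a) * (s * star a).
  by rewrite star_mul starK ss !mulrA.
exact: cpos_star_mul.
Qed.

Lemma inner_cpos w : cpos (inner w w).
Proof. by have [b ->] := inner_ge0 w; exact: cpos_star_mul. Qed.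

Lemma rnorm_inner w : rnorm (inner w w) = rnorm w ^+ 2.
Proof.
by apply: complexI; rewrite rmorphXn /= !rnormE [in RHS]inner_norm sqrtCK.
Qed.

Lemma innerDr w v v' : inner w (v + v') = inner w v + inner w v'.
Proof. by rewrite innerC innerD starD -!innerC. Qed.

Lemma innerZl z w v : inner (z *: w) v = z *: inner w v.
Proof.
by rewrite -[w in LHS]hact1 -hactZ inner_act -scalerAl mul1r.
Qed.

Lemma innerNl w v : inner (- w) v = - inner w v.
Proof. by rewrite -scaleN1r innerZl scaleN1r. Qed.

Lemma innerNr w v : inner w (- v) = - inner w v.
Proof. by rewrite innerC innerNl starN -innerC. Qed.

Lemma inner_scale_r t w v : inner w (t%:C *: v) = t%:C *: inner w v.
Proof. by rewrite innerC innerZl starZr -innerC. Qed.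

(** Let [t] be the square of the norm of [v]. Positivity of [<x, x>] for
    [x = t w - <w, v> v] gives the inequality [t <w, w> >= a a^*], where
    [a = <w, v>]. *)
Theorem cauchy_schwarz w v : rnorm (inner w v) <= rnorm w * rnorm v.
Proof.
have [v0|vn0] := eqVneq v 0.
  rewrite v0 innerC -[0 : M](scale0r 0) innerZl scale0r star0 rnorm0.
  by rewrite mulr_ge0 // rnorm_ge0.
pose t := rnorm v ^+ 2; have t0 : 0 < t.
  rewrite exprn_gt0 // lt0r rnorm_ge0 andbT.
  by apply: contraNneq vn0 => /rnorm_eq0 ->.
pose a := inner w v; pose x := t%:C *: w - hact a v.
have vw : inner (hact a v) w = a * star a by rewrite inner_act innerC.
have wv : inner w (hact a v) = a * star a.
  by rewrite innerC vw star_mul starK.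
have vv : inner (hact a v) (hact a v) = a * inner v v * star a.
  rewrite inner_act innerC inner_act star_mul -mulrA; congr (_ * (_ * _)).
  by rewrite -innerC.
have xx : inner x x = (t * t)%:C *: inner w w - t%:C *: (a * star a) -
    t%:C *: (a * star a) + a * inner v v * star a.
  rewrite /x innerD innerNl !innerDr !innerNr !innerZl !inner_scale_r vw wv vv.
  by rewrite scalerRA opprD opprK addrA.
pose c := inner v v; have pc : cpos (t%:C%:A - c).
  by apply: cpos_sub_scalar; rewrite ?rnorm_inner //; exact/cpos_sa/inner_cpos.
have pa : cpos (t%:C *: inner w w - a * star a).
  have -> : t%:C *: inner w w - a * star a =
      (t^-1)%:C *: (inner x x + a * (t%:C%:A - c) * star a).
    have -> : a * (t%:C%:A - c) * star a =
        t%:C *: (a * star a) - a * c * star a.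
      by rewrite mulrBr mulrBl -scalerAr mulr1 -scalerAl.
    rewrite xx addrACA subrr addr0 subrK scalerBr !scalerRA mulrA.
    by rewrite mulVf ?gt_eqF // mul1r scale1r.
  apply: cposZ; first by rewrite invr_ge0 ltW.
  by apply: cposD; [exact: inner_cpos|exact: cpos_conj].
have paa : cpos (a * star a) by rewrite -{1}[a]starK; exact: cpos_star_mul.
have := cpos_norm_mono paa pa.
rewrite rnorm_mul_star rnormZ ger0_norm ?(ltW t0) //.
rewrite rnorm_inner -exprMn ler_sqr ?nnegrE ?mulr_ge0 ?rnorm_ge0 //.
by rewrite mulrC.
Qed.

End HilbertModules.

Section HilbertMorphisms.
Variables (R : realType) (A B : cstarType R) (M : hilbertModType A).
Variables (N : hilbertModType B) (theta : A -> B) (Theta : M -> N).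
Hypothesis mor : hilbert_morphism theta Theta.
Implicit Types w v : M.

Lemma hmor_inner w v : theta (inner w v) = inner (Theta w) (Theta v).
Proof. by have [_ _ _ mi] := mor. Qed.

Lemma hmor_norm w : rnorm (Theta w) <= rnorm w.
Proof.
have [ms _ _ _] := mor.
rewrite -ler_sqr ?nnegrE ?rnorm_ge0 // -!rnorm_inner -hmor_inner.
exact: mor_norm.
Qed.

End HilbertMorphisms.

Section ProjectedMorphisms.
Variables (R : realType) (A1 A2 B : cstarType R).
Variables (M1 : hilbertModType A1) (M2 : hilbertModType A2).
Variable N : hilbertModType B.

Lemma star_morphism_fst (q : A1 -> B) : star_morphism q ->
  star_morphism (fun d : (A1 * A2)%type => q d.1).
Proof.
move=> [q_lin [q1 qM] q_star]; split.
- by move=> z a b; exact: q_lin.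
- by split; [exact: q1|move=> a b; exact: qM].
- by move=> a; exact: q_star.
Qed.

Lemma star_morphism_snd (q : A2 -> B) : star_morphism q ->
  star_morphism (fun d : (A1 * A2)%type => q d.2).
Proof.
move=> [q_lin [q1 qM] q_star]; split.
- by move=> z a b; exact: q_lin.
- by split; [exact: q1|move=> a b; exact: qM].
- by move=> a; exact: q_star.
Qed.

Lemma hilbert_morphism_fst (q : A1 -> B) (Q : M1 -> N) :
  hilbert_morphism q Q ->
  @hilbert_morphism R (A1 * A2)%type B (M1 * M2)%type N
    (fun d => q d.1) (fun w => Q w.1).
Proof.
move=> [q_mor Q_lin Qact Qinner]; split; first exact: star_morphism_fst.
- by move=> z w v; exact: Q_lin.
- by move=> a w; exact: Qact.
- by move=> w v; exact: Qinner.
Qed.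

Lemma hilbert_morphism_snd (q : A2 -> B) (Q : M2 -> N) :
  hilbert_morphism q Q ->
  @hilbert_morphism R (A1 * A2)%type B (M1 * M2)%type N
    (fun d => q d.2) (fun w => Q w.2).
Proof.
move=> [q_mor Q_lin Qact Qinner]; split; first exact: star_morphism_snd.
- by move=> z w v; exact: Q_lin.
- by move=> a w; exact: Qact.
- by move=> w v; exact: Qinner.
Qed.

End ProjectedMorphisms.

(** * The Monge-Kantorovich distance and the weak* topology *)

Section MongeKantorovich.
Variables (R : realType) (A : cstarType R) (L : A -> \bar R).
Implicit Types (phi psi : A -> R[i]^o) (a : A) (c d e : R).

Lemma mk_dist_ub phi psi a : (L a <= 1)%E ->
  ((rnorm (phi a - psi a))%:E <= mk_dist L phi psi)%E.
Proof. by move=> La; apply: ereal_sup_ubound; exists a. Qed.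

Lemma mk_dist_le phi psi (x : \bar R) :
  (forall a, (L a <= 1)%E -> ((rnorm (phi a - psi a))%:E <= x)%E) ->
  (mk_dist L phi psi <= x)%E.
Proof. by move=> le; apply: ge_ereal_sup => _ [a La <-]; exact: le. Qed.

Lemma mk_dist_sym phi psi : mk_dist L phi psi = mk_dist L psi phi.
Proof.
by congr ereal_sup; apply/seteqP; split => _ [a La <-]; exists a => //;
  rewrite rnorm_distC.
Qed.

Hypothesis L0 : L 0 = 0%E.

Lemma mk_dist_ge0 phi psi : (0 <= mk_dist L phi psi)%E.
Proof.
apply: le_trans (mk_dist_ub phi psi (a := 0) _); last by rewrite L0.
by rewrite lee_fin rnorm_ge0.
Qed.

Lemma mk_dist_refl phi : mk_dist L phi phi = 0%E.
Proof.
apply/eqP; rewrite eq_le mk_dist_ge0 andbT; apply: mk_dist_le => a _.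
by rewrite subrr rnorm0.
Qed.

Lemma mk_dist_triangle phi psi chi :
  (mk_dist L phi chi <= mk_dist L phi psi + mk_dist L psi chi)%E.
Proof.
apply: mk_dist_le => a La.
apply: le_trans (leeD (mk_dist_ub phi psi La) (mk_dist_ub psi chi La)).
by rewrite -EFinD lee_fin rnorm_triangle.
Qed.

End MongeKantorovich.

Section Metrization.
Variables (R : realType) (A : cstarType R) (L : A -> \bar R).
Hypothesis L_sa : dom L `<=` sa A.
Hypothesis L_dense : sa A `<=` closure (dom L).
Hypothesis L_seminorm : seminorm [set t%:C | t in [set: R]] L.
Implicit Types (phi psi : A -> R[i]^o) (a : A) (c d e : R).

Lemma dense_approx a e : sa A a -> 0 < e ->
  exists2 b, dom L b & rnorm (a - b) < e.
Proof.
move=> /L_dense cl e0.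
have eC : 0 < e%:C :> R[i] by rewrite ltcR.
have [b [Lb ab]] := cl _ (nbhsx_ballx a _ eC).
by exists b => //; move: ab; rewrite -ball_normE /= -rnormE ltcR.
Qed.

Lemma mk_dist_dom a : dom L a -> exists2 K : R, 0 < K &
  forall phi psi d, states A phi -> states A psi ->
    (mk_dist L phi psi < d%:E)%E -> rnorm (phi a - psi a) <= K * d.
Proof.
have [L0 _ L_ge0 L_hom] := L_seminorm; move=> La.
have [l lE] : exists l, L a = l%:E.
  by exists (fine (L a)); rewrite fineK // fin_numE gt_eqF ?lt_eqF //
    (lt_le_trans _ (L_ge0 a)).
have l0 : 0 <= l by rewrite -lee_fin -lE.
have l1 : 0 < l + 1 by rewrite ltr_wpDl.
exists (l + 1) => // phi psi d /state_positive sphi /state_positive spsi dist.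
pose b := ((l + 1)^-1)%:C *: a.
have Lb : (L b <= 1)%E.
  have Rl : [set t%:C | t in [set: R]] ((l + 1)^-1)%:C by exists ((l + 1)^-1).
  rewrite (L_hom _ _ Rl La).
  rewrite real_norm /= lE -EFinM lee_fin ger0_norm ?invr_ge0 ?(ltW l1) //.
  by rewrite mulrC ler_pdivrMr // mul1r lerDl.
have := le_lt_trans (mk_dist_ub phi psi Lb) dist.
rewrite lte_fin (pfunZ sphi) (pfunZ spsi) -mulrBr.
rewrite [rnorm _](rnormZ (V := R[i]^o)) ger0_norm ?invr_ge0 ?(ltW l1) //.
by rewrite ltr_pdivrMl // => /ltW.
Qed.

(** States are bounded by the norm on self-adjoint elements, among which [dom L]
    is dense; hence convergence for the Monge-Kantorovich distance implies weak*
    convergence. *)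
Lemma mk_dist_controls a e : 0 < e -> exists2 d, 0 < d &
  forall phi psi, states A phi -> states A psi ->
    (mk_dist L phi psi < d%:E)%E -> rnorm (phi a - psi a) < e.
Proof.
have sa_case b c : sa A b -> 0 < c -> exists2 d, 0 < d &
    forall phi psi, states A phi -> states A psi ->
    (mk_dist L phi psi < d%:E)%E -> rnorm (phi b - psi b) < c.
  move=> sb c0; have c4 : 0 < c / 4 by rewrite divr_gt0.
  have [x Lx bx] := dense_approx sb c4.
  have [K K0 KP] := mk_dist_dom Lx.
  exists (c / 4 / K); first by rewrite divr_gt0.
  move=> phi psi sphi spsi /(KP _ _ _ sphi spsi).
  rewrite mulrCA mulfV ?gt_eqF // mulr1 => le.
  have sbx : sa A (b - x) by apply: saB => //; exact: L_sa.
  have := state_sa_norm sphi sbx; have := state_sa_norm spsi sbx.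
  have -> : phi b - psi b = (phi (b - x) - psi (b - x)) + (phi x - psi x).
    rewrite (pfunB (state_positive sphi)) (pfunB (state_positive spsi)).
    ring.
  have := rnormD (phi (b - x) - psi (b - x)) (phi x - psi x).
  have := rnormB (phi (b - x)) (psi (b - x)).
  by move=> ? ? ? ?; lra.
move=> e0; have e2 : 0 < e / 2 by rewrite divr_gt0.
have [d1 d10 P1] := sa_case _ _ (sa_re_part a) e2.
have [d2 d20 P2] := sa_case _ _ (sa_im_part a) e2.
exists (Num.min d1 d2); first by rewrite lt_min d10.
move=> phi psi sphi spsi.
rewrite EFin_min lt_min => /andP[/(P1 _ _ sphi spsi) re /(P2 _ _ sphi spsi) im].
rewrite (pfun_re_im (state_positive sphi)) (pfun_re_im (state_positive spsi)).
rewrite opprD addrACA -mulrBr (le_lt_trans (rnormD _ _)) //.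
by rewrite [X in _ + X](rnorm_iZ (V := R[i]^o)) [ltRHS]splitr ltrD.
Qed.

(** Only the continuity of the distance for the weak* topology has to be checked,
    the converse being [mk_dist_controls]. *)
Lemma metrizes_states :
  (forall phi psi, states A phi -> states A psi ->
     (mk_dist L phi psi < +oo)%E) ->
  (forall phi e, states A phi -> 0 < e ->
     \forall psi \near (phi : {ptws A -> R[i]^o}), states A psi ->
       (mk_dist L phi psi < e%:E)%E) ->
  @metrizes R {ptws A -> R[i]^o} (states A) (mk_dist L).
Proof.
have [L0 _ _ _] := L_seminorm.
move=> finite weak; split.
  split.
  - by move=> phi psi sphi spsi; rewrite mk_dist_ge0 // finite.
  - move=> phi psi sphi spsi; split; last by move=> ->; exact: mk_dist_refl.
    move=> dist0; apply/funext => a; apply/eqP; rewrite -subr_eq0; apply/eqP.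
    apply: (@rnorm_small _ _ _ 1) => e e0; rewrite mul1r.
    have [d d0 dP] := mk_dist_controls a e0.
    by apply/ltW/dP => //; rewrite dist0 lte_fin.
  - by move=> phi psi _ _; exact: mk_dist_sym.
  - by move=> phi psi chi _ _ _; exact: mk_dist_triangle.
move=> phi sphi X; split; last first.
  move=> [e e0 eX]; have := weak _ _ sphi e0.
  apply: (@filterS _ _ (nbhs_filter (phi : {ptws A -> R[i]^o}))).
  by move=> psi dpsi spsi; apply: eX; split => //; exact: dpsi.
move=> nX.
(* The balls of the distance around [phi] generate a filter; it converges to
   [phi] at every point, hence contains the weak* neighborhoods of [phi]. *)
pose G := filter_from [set e : R | 0 < e]
  (fun e => [set psi : {ptws A -> R[i]^o} | states A psi /\
                  (mk_dist L phi psi < e%:E)%E]).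
have FG : Filter G.
  apply: filter_from_filter; first by exists 1 => /=.
  move=> d e d0 e0; exists (Num.min d e); first by rewrite /= lt_min d0.
  by move=> psi [spsi]; rewrite EFin_min lt_min => /andP[].
have Gphi : {ptws, G --> (phi : A -> R[i]^o)}.
  apply/pointwise_cvgP => a; apply/cvgrPdist_lt => e e0.
  have eR : e = (complex.Re e)%:C by rewrite RRe_real // gtr0_real.
  have [|d d0 dP] := mk_dist_controls a (e := complex.Re e).
    by rewrite -ltcR -eR.
  exists d => // psi [spsi dist]; rewrite /= -rnormE eR ltcR.
  exact: dP.
by have [e e0 eX] := Gphi _ nX; exists e => // psi [spsi dist]; apply: (eX psi).
Qed.

End Metrization.

(** * Coupled seminorms on a direct sum *)

Section CoupledSeminorm.
Variables (R : realType) (V1 V2 W : normedModType R[i]).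
Variables (T1 : V1 -> W) (T2 : V2 -> W) (N1 : V1 -> \bar R) (N2 : V2 -> \bar R).
Variable eps : R.
Hypotheses (T1_lin : linear T1) (T2_lin : linear T2).
Hypotheses (T1_le : forall x, rnorm (T1 x) <= rnorm x).
Hypotheses (T2_le : forall x, rnorm (T2 x) <= rnorm x).
Hypothesis eps0 : 0 < eps.
Implicit Types x y : (V1 * V2)%type.

Let gap x := T1 x.1 - T2 x.2.

(** The pattern common to the Lipschitz seminorm and to the D-norm of the
    composite tunnel. *)
Definition coupled x : \bar R :=
  maxe (maxe (N1 x.1) (N2 x.2)) (1 / eps * rnorm (gap x))%:E.

Lemma coupled_le x c : (coupled x <= c%:E)%E <->
  [/\ (N1 x.1 <= c%:E)%E, (N2 x.2 <= c%:E)%E & rnorm (gap x) <= eps * c].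
Proof.
rewrite /coupled !ge_max lee_fin mul1r ler_pdivrMl //.
by split=> [/andP[/andP[]]|[-> -> ->]].
Qed.

Lemma coupled_ge1 x : (N1 x.1 <= coupled x)%E.
Proof. by rewrite /coupled !le_max lexx. Qed.

Lemma coupled_ge2 x : (N2 x.2 <= coupled x)%E.
Proof. by rewrite /coupled !le_max lexx orbT. Qed.

Lemma dom_coupled x : dom coupled x <-> dom N1 x.1 /\ dom N2 x.2.
Proof.
rewrite /dom /= /coupled !gt_max ltry andbT.
by split=> [/andP[]|[-> ->]].
Qed.

Let T1D x y : T1 (x.1 + y.1) = T1 x.1 + T1 y.1.
Proof. by have := T1_lin 1 x.1 y.1; rewrite !scale1r. Qed.

Let T2D x y : T2 (x.2 + y.2) = T2 x.2 + T2 y.2.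
Proof. by have := T2_lin 1 x.2 y.2; rewrite !scale1r. Qed.

Let gapD x y : gap (x + y) = gap x + gap y.
Proof. by rewrite /gap T1D T2D opprD addrACA. Qed.

Let gap0 : gap 0 = 0.
Proof. by apply: (addrI (gap 0)); rewrite -gapD !addr0. Qed.

Let gapZ k x : gap (k *: x) = k *: gap x.
Proof.
have T10 : T1 0 = 0.
  by apply: (addrI (T1 0)); rewrite -(T1D 0 0) !addr0.
have T20 : T2 0 = 0.
  by apply: (addrI (T2 0)); rewrite -(T2D 0 0) !addr0.
rewrite /gap scalerBr; have := T1_lin k x.1 0; have := T2_lin k x.2 0.
by rewrite T10 T20 !addr0 => <- <-.
Qed.

Lemma coupled_seminorm K : seminorm K N1 -> seminorm K N2 -> seminorm K coupled.
Proof.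
move=> [N10 N1D N1_ge0 N1Z] [N20 N2D N2_ge0 N2Z]; split.
- by rewrite /coupled gap0 rnorm0 mulr0 N10 N20 !maxxx.
- move=> x y; rewrite /coupled !ge_max -andbA; apply/and3P; split.
  + by rewrite (le_trans (N1D _ _)) // leeD // coupled_ge1.
  + by rewrite (le_trans (N2D _ _)) // leeD // coupled_ge2.
  + rewrite gapD.
    have le z : ((1 / eps * rnorm (gap z))%:E <= coupled z)%E.
      by rewrite /coupled le_max lexx orbT.
    apply: le_trans (leeD (le x) (le y)); rewrite -EFinD lee_fin -mulrDr.
    by apply: ler_wpM2l (rnormD _ _); rewrite mul1r invr_ge0 ltW.
- by move=> x; rewrite (le_trans (N1_ge0 x.1)) // coupled_ge1.
- move=> k x Kk /dom_coupled[d1 d2].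
  rewrite /coupled gapZ (N1Z k x.1 Kk d1) (N2Z k x.2 Kk d2).
  have fin1 : N1 x.1 \is a fin_num by rewrite ge0_fin_numE // N1_ge0.
  have fin2 : N2 x.2 \is a fin_num by rewrite ge0_fin_numE.
  have k0 : 0 <= complex.Re `|k| := rnorm_ge0 (k : R[i]^o).
  rewrite rnormZc -(fineK fin1) -(fineK fin2) -!EFinM -!EFin_max -EFinM.
  by congr (_%:E); rewrite mulrCA -!maxr_pMr.
Qed.

Lemma gap_lt_near x a : a < rnorm (gap x) ->
  \forall y \near x, a < rnorm (gap y).
Proof.
move=> ax; pose d := (rnorm (gap x) - a) / 2.
have d0 : 0 < d by rewrite divr_gt0 // subr_gt0.
have dC : 0 < d%:C :> R[i] by rewrite ltcR.
exists (ball x.1 d%:C, ball x.2 d%:C).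
  by split; exact: nbhsx_ballx.
move=> y [/=]; rewrite -!ball_normE /= -!rnormE !ltcR => y1 y2.
have gapB : gap x = gap y + gap (x - y) by rewrite -gapD addrC subrK.
have := rnormD (gap y) (gap (x - y)); rewrite -gapB.
have := rnormB (T1 (x - y).1) (T2 (x - y).2); rewrite -/(gap _).
have := T1_le (x.1 - y.1); have := T2_le (x.2 - y.2).
by move: y1 y2; rewrite /d /=; lra.
Qed.

Lemma coupled_lsc : lower_semicontinuous N1 -> lower_semicontinuous N2 ->
  lower_semicontinuous coupled.
Proof.
move=> lsc1 lsc2 x a; rewrite {1}/coupled !lt_max => /orP[/orP[]|].
- move=> /lsc1[U xU Ua]; exists (fst @^-1` U); first exact: cvg_fst xU.
  by move=> y Uy; rewrite (lt_le_trans (Ua _ Uy)) // coupled_ge1.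
- move=> /lsc2[U xU Ua]; exists (snd @^-1` U); first exact: cvg_snd xU.
  by move=> y Uy; rewrite (lt_le_trans (Ua _ Uy)) // coupled_ge2.
- rewrite lte_fin mul1r ltr_pdivlMl // => /gap_lt_near near_gap.
  exists [set y | eps * a < rnorm (gap y)] => // y /= ay.
  by rewrite /coupled lt_max lte_fin mul1r ltr_pdivlMl // ay orbT.
Qed.

Lemma coupled_dense x : closure (dom N1) x.1 -> closure (dom N2) x.2 ->
  closure (dom coupled) x.
Proof.
move=> cl1 cl2 U [[U1 U2] /= [xU1 xU2] U12].
have [y1 [Ny1 Uy1]] := cl1 _ xU1; have [y2 [Ny2 Uy2]] := cl2 _ xU2.
by exists (y1, y2); split; [exact/dom_coupled|exact: U12].
Qed.

Lemma coupled_compact :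
  compact [set x | (N1 x <= 1)%E] -> compact [set x | (N2 x <= 1)%E] ->
  compact [set x | (coupled x <= 1)%E].
Proof.
move=> K1 K2.
have -> : [set x | (coupled x <= 1)%E] =
    ([set x | (N1 x <= 1)%E] `*` [set x | (N2 x <= 1)%E]) `&`
    [set x | rnorm (gap x) <= eps].
  apply/seteqP; split => x /=; rewrite coupled_le mulr1.
    by move=> [].
  by move=> [[]].
apply: compact_closedI; first exact: compact_setX.
rewrite -[X in closed X]setCK closedC openE => x /=.
move=> /negP; rewrite -ltNge => /gap_lt_near; apply: filterS => y /=.
by rewrite ltNge => /negP.
Qed.

End CoupledSeminorm.

(** * States of a direct sum *)

Section DirectSumStates.
Variables (R : realType) (A B : cstarType R).
Implicit Types (phi psi : (A * B)%type -> R[i]^o) (a : A) (b : B).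

Lemma rnorm_fst (V W : normedModType R[i]) (x : (V * W)%type) :
  rnorm x.1 <= rnorm x.
Proof.
have : `|x| <= (rnorm x)%:C by rewrite rnormE.
by rewrite prod_norm_le => /andP[+ _]; rewrite -rnormE lecR.
Qed.

Lemma rnorm_snd (V W : normedModType R[i]) (x : (V * W)%type) :
  rnorm x.2 <= rnorm x.
Proof.
have : `|x| <= (rnorm x)%:C by rewrite rnormE.
by rewrite prod_norm_le => /andP[_]; rewrite -rnormE lecR.
Qed.

Lemma pfun_pair phi a b : positive_functional phi ->
  phi (a, b) = phi (a, 0) + phi (0, b).
Proof.
by move=> pf; rewrite -(pfunD pf); congr phi; congr pair; rewrite ?addr0 ?add0r.
Qed.

Lemma pfun_fst phi : positive_functional phi ->
  positive_functional (fun a => phi (a, 0)).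
Proof.
move=> pf; split=> [z a b|a].
  have -> : (z *: a + b, 0) = z *: ((a, 0) : (A * B)%type) + (b, 0).
    by apply: injective_projections => //=; rewrite scaler0 addr0.
  by rewrite (pfunD pf) (pfunZ pf).
have [_ pos] := pf; have := pos (a, 0); congr (_ <= phi _).
by congr pair; exact: mulr0.
Qed.

Lemma pfun_snd phi : positive_functional phi ->
  positive_functional (fun b => phi (0, b)).
Proof.
move=> pf; split=> [z a b|b].
  have -> : (0, z *: a + b) = z *: ((0, a) : (A * B)%type) + (0, b).
    by apply: injective_projections => //=; rewrite scaler0 addr0.
  by rewrite (pfunD pf) (pfunZ pf).
have [_ pos] := pf; have := pos (0, b); congr (_ <= phi _).
by congr pair; exact: mulr0.
Qed.

Lemma state_snd_unit phi : states _ phi -> phi (0, 1) = 1 - phi (1, 0).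
Proof.
move=> sp; have e : phi 1 = phi (1, 0) + phi (0, 1).
  exact: (pfun_pair 1 1 (state_positive sp)).
by rewrite -[X in X - _](state1 sp) e addrC addKr.
Qed.

(** A positive functional of weight [0] vanishes, so any state will do for it. *)
Lemma pfun_normalize (f : A -> R[i]^o) : positive_functional f ->
  exists2 phi, states A phi & forall a, f a = f 1 * phi a.
Proof.
move=> pf; have [f0|f0] := eqVneq (f 1) 0.
  have [mu smu] := states_nonempty A; exists mu => // a.
  have sa0 c : sa A c -> f c = 0.
    move=> /(pfun_sa_norm pf); rewrite f0 mul0r => c0.
    by apply: rnorm_eq0; apply/eqP; rewrite eq_le c0 rnorm_ge0.
  rewrite f0 mul0r (pfun_re_im pf).
  by rewrite !sa0 ?mulr0 ?addr0 //; [exact: sa_im_part|exact: sa_re_part].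
exists (fun a => (f 1)^-1 * f a); last by move=> a; rewrite mulrA mulfV ?mul1r.
split.
- by move=> z a b; rewrite (pfunD pf) (pfunZ pf) mulrDr mulrCA.
- move=> a; apply: mulr_ge0; first by rewrite invr_ge0; exact: pfun1_ge0.
  by have [_] := pf; apply.
- by rewrite mulVf.
Qed.

(** The slices are unital and positive, so that they pull states of the direct sum
    back to states of the summands, without any division by the weight of a
    summand, which may vanish. *)
Definition slice1 (nu : A -> R[i]^o) (a : A) : (A * B)%type := (a, (nu a)%:A).
Definition slice2 (nu : B -> R[i]^o) (b : B) : (A * B)%type := ((nu b)%:A, b).

Lemma slice1E phi nu a : states _ phi ->
  phi (slice1 nu a) = phi (a, 0) + nu a * phi (0, 1).
Proof.
move=> sp; have pf := state_positive sp.
by rewrite (pfun_pair _ _ pf) (pfunZ (pfun_snd pf)).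
Qed.

Lemma slice2E phi nu b : states _ phi ->
  phi (slice2 nu b) = phi (0, b) + nu b * phi (1, 0).
Proof.
move=> sp; have pf := state_positive sp.
by rewrite (pfun_pair _ _ pf) (pfunZ (pfun_fst pf)) addrC.
Qed.

Lemma state_slice1 phi nu : states _ phi -> states A nu ->
  states A (phi \o slice1 nu).
Proof.
move=> sp snu; have pf := state_positive sp; have pnu := state_positive snu.
split.
- move=> z a c /=.
  rewrite !slice1E // (pfunD (pfun_fst pf)) (pfunZ (pfun_fst pf)).
  rewrite (pfunD pnu) (pfunZ pnu) /GRing.scale /=; ring.
- move=> a /=; rewrite slice1E //; apply: addr_ge0.
    by have [_] := pfun_fst pf; apply.
  by apply: mulr_ge0; [have [_] := pnu; apply|exact: pfun1_ge0 (pfun_snd pf)].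
- by rewrite /= slice1E // (state1 snu) mul1r state_snd_unit // addrC subrK.
Qed.

Lemma state_slice2 phi nu : states _ phi -> states B nu ->
  states B (phi \o slice2 nu).
Proof.
move=> sp snu; have pf := state_positive sp; have pnu := state_positive snu.
split.
- move=> z b c /=.
  rewrite !slice2E // (pfunD (pfun_snd pf)) (pfunZ (pfun_snd pf)).
  rewrite (pfunD pnu) (pfunZ pnu) /GRing.scale /=; ring.
- move=> b /=; rewrite slice2E //; apply: addr_ge0.
    by have [_] := pfun_snd pf; apply.
  by apply: mulr_ge0; [have [_] := pnu; apply|exact: pfun1_ge0 (pfun_fst pf)].
- by rewrite /= slice2E // (state1 snu) mul1r state_snd_unit // subrK.
Qed.

End DirectSumStates.

Arguments slice1 {R A B} nu a.
Arguments slice2 {R A B} nu b.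

Section ConvexStates.
Variables (R : realType) (A B : cstarType R).

Lemma state_convex (phi psi : A -> R[i]^o) (t : R) :
  states A phi -> states A psi -> 0 <= t <= 1 ->
  states A (fun a => t%:C * phi a + (1 - t)%:C * psi a).
Proof.
move=> sphi spsi /andP[t0 t1].
have pphi := state_positive sphi; have ppsi := state_positive spsi; split.
- move=> z a b; rewrite (pfunD pphi) (pfunZ pphi) (pfunD ppsi) (pfunZ ppsi).
  rewrite /GRing.scale /=; ring.
- move=> a; have [_ pos1] := pphi; have [_ pos2] := ppsi.
  by apply: addr_ge0; apply: mulr_ge0 => //; rewrite lecR ?subr_ge0.
- by rewrite (state1 sphi) (state1 spsi) !mulr1 -rmorphD addrC subrK.
Qed.

Lemma state_decomposition (phi : (A * B)%type -> R[i]^o) : states _ phi ->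
  exists t phi1 phi2, [/\ 0 <= t <= 1, states A phi1, states B phi2 &
    forall d, phi d = t%:C * phi1 d.1 + (1 - t)%:C * phi2 d.2].
Proof.
move=> sp; have pf := state_positive sp.
have p1 := pfun_fst pf; have p2 := pfun_snd pf.
have [phi1 s1 E1] := pfun_normalize p1; have [phi2 s2 E2] := pfun_normalize p2.
pose t := complex.Re (phi (1, 0)); have tE : phi (1, 0) = t%:C := pfun1E p1.
have uE : phi (0, 1) = (1 - t)%:C.
  by rewrite state_snd_unit // rmorphB rmorph1 tE.
exists t, phi1, phi2; split => //; last first.
  by move=> [a b]; rewrite (pfun_pair _ _ pf) E1 E2 uE tE.
have := pfun1_ge0 p1; have := pfun1_ge0 p2; rewrite uE tE !lecR subr_ge0.
by move=> -> ->.
Qed.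

End ConvexStates.

(** * The direct sum as a quantum compact metric space *)

Lemma near_precomp (R : realType) (A A' : cstarType R) (s : A' -> A)
    (phi : A -> R[i]^o) (P : set (A' -> R[i]^o)) :
  (\forall psi \near ((phi \o s) : {ptws A' -> R[i]^o}), P psi) ->
  \forall psi \near (phi : {ptws A -> R[i]^o}), P (psi \o s).
Proof.
move=> nP; pose G : set_system (A' -> R[i]^o) :=
  (fun psi : {ptws A -> R[i]^o} => (psi \o s : A' -> R[i]^o)) @
  nbhs (phi : {ptws A -> R[i]^o}).
suff : {ptws, G --> (phi \o s)} by move=> /(_ _ nP).
apply/pointwise_cvgP => a.
have : {ptws, nbhs (phi : {ptws A -> R[i]^o}) --> phi} by [].
by move=> /pointwise_cvgP/(_ (s a)).
Qed.

Lemma near_rnorm (R : realType) (V : normedModType R[i]) (x : V) (e : R) :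
  0 < e -> nbhs x [set y | rnorm (x - y) < e].
Proof.
move=> e0; have eC : 0 < e%:C :> R[i] by rewrite ltcR.
apply: filterS (nbhsx_ballx x _ eC) => y.
by rewrite -ball_normE /= -rnormE ltcR.
Qed.

Lemma near_eval (R : realType) (A : cstarType R) (phi : A -> R[i]^o) (a : A)
    (e : R) : 0 < e ->
  \forall psi \near (phi : {ptws A -> R[i]^o}), rnorm (phi a - psi a) < e.
Proof.
move=> e0; have := @proj_continuous A (fun=> R[i]^o) a phi.
move=> /(_ [set z | rnorm (phi a - z) < e]); apply.
exact: (near_rnorm (phi a)).
Qed.

Section CoupledQuantumMetric.
Variables (R : realType) (F : R -> R -> R -> R -> R) (A1 A2 B : cstarType R).
Variables (L1 : A1 -> \bar R) (L2 : A2 -> \bar R) (eps : R).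
Variables (th : A1 -> B) (ph : A2 -> B).
Hypotheses (F_leibniz : permissible_leibniz F).
Hypotheses (Q1 : is_qcms F L1) (Q2 : is_qcms F L2).
Hypotheses (th_mor : star_morphism th) (ph_mor : star_morphism ph).
Hypothesis eps0 : 0 < eps.

Let L : (A1 * A2)%type -> \bar R := coupled th ph L1 L2 eps.

Let th_lin : linear th. Proof. by case: th_mor. Qed.
Let ph_lin : linear ph. Proof. by case: ph_mor. Qed.

Lemma dom_coupled_sa : dom L `<=` sa (A1 * A2)%type.
Proof.
move=> [a1 a2] /dom_coupled[/(qcms_sa Q1) s1 /(qcms_sa Q2) s2].
by rewrite /sa /=; congr pair.
Qed.

Lemma coupled_sa_dense : sa (A1 * A2)%type `<=` closure (dom L).
Proof.
move=> [a1 a2] [s1 s2].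
by apply: coupled_dense; [exact: (qcms_dense Q1)|exact: (qcms_dense Q2)].
Qed.

Lemma coupled_L_seminorm : seminorm [set t%:C | t in [set: R]] L.
Proof.
by apply: coupled_seminorm => //; [case: Q1|case: Q2].
Qed.

(** Let [t] be the weight of the first summand in [phi]. The value [phi (a1, a2)]
    is the sum of the two slices of [phi] at [a1] and [a2], minus
    [(1 - t) mu (th a1) + t mu (ph a2)]. Between two states, the latter term
    changes by the difference of the weights times [mu (th a1 - ph a2)], which is
    at most [eps]. *)
Lemma coupled_mk_dist_le mu phi psi : states B mu ->
  states (A1 * A2)%type phi -> states (A1 * A2)%type psi ->
  (mk_dist L phi psi <=
   mk_dist L1 (phi \o slice1 (mu \o th)) (psi \o slice1 (mu \o th)) +
   mk_dist L2 (phi \o slice2 (mu \o ph)) (psi \o slice2 (mu \o ph)) +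
   (eps * rnorm (phi (1, 0) - psi (1, 0)))%:E)%E.
Proof.
move=> smu sphi spsi; apply: mk_dist_le => -[a1 a2].
move=> /(coupled_le th ph L1 L2 eps0)/= [La1 La2]; rewrite mulr1 => gap.
have s1 := state_comp th_mor smu; have s2 := state_comp ph_mor smu.
have sgap : sa B (th a1 - ph a2).
  apply: saB; [apply: (mor_sa th_mor); apply: (qcms_sa Q1)|
               apply: (mor_sa ph_mor); apply: (qcms_sa Q2)].
    exact: le_lt_trans La1 (ltry _).
  exact: le_lt_trans La2 (ltry _).
have b1 := mk_dist_ub (phi \o slice1 (mu \o th)) (psi \o slice1 (mu \o th)) La1.
have b2 := mk_dist_ub (phi \o slice2 (mu \o ph)) (psi \o slice2 (mu \o ph)) La2.
apply: le_trans (leeD (leeD b1 b2) (lexx _)).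
rewrite -!EFinD lee_fin.
have -> : phi (a1, a2) - psi (a1, a2) =
    ((phi \o slice1 (mu \o th)) a1 - (psi \o slice1 (mu \o th)) a1) +
    ((phi \o slice2 (mu \o ph)) a2 - (psi \o slice2 (mu \o ph)) a2) +
    mu (th a1 - ph a2) * (phi (1, 0) - psi (1, 0)).
  rewrite /= !slice1E // !slice2E // !state_snd_unit //.
  rewrite (pfunB (state_positive smu)).
  rewrite (pfun_pair _ _ (state_positive sphi)).
  rewrite (pfun_pair _ _ (state_positive spsi)) /=; ring.
rewrite (le_trans (rnormD _ _)) // lerD //; first exact: rnormD.
rewrite [leLHS](rnormZc (V := R[i]^o)) ler_wpM2r ?rnorm_ge0 //.
exact: le_trans (state_sa_norm smu sgap) gap.
Qed.

Let qcms_near (A' : cstarType R) (L' : A' -> \bar R) (Q : is_qcms F L') phi e :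
  states A' phi -> 0 < e ->
  \forall psi \near (phi : {ptws A' -> R[i]^o}), states A' psi ->
    (mk_dist L' phi psi < e%:E)%E.
Proof.
move=> sphi e0; have [_ top] := qcms_metrizes Q.
pose X := [set psi | states A' psi /\ (mk_dist L' phi psi < e%:E)%E].
have /(top phi sphi X).2 wX : exists2 d : R, 0 < d &
    [set y | states A' y /\ (mk_dist L' phi y < d%:E)%E] `<=` X by exists e.
apply: (@filterS _ _ (nbhs_filter (phi : {ptws A' -> R[i]^o}))) wX.
by move=> psi h spsi; case: (h spsi).
Qed.

(** By [coupled_mk_dist_le], the distance is finite and weak* continuous because
    those of the summands are, and because the slices are weak* continuous. *)
Lemma coupled_metrizes :
  @metrizes R {ptws (A1 * A2)%type -> R[i]^o} (states (A1 * A2)%type)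
    (mk_dist L).
Proof.
have [mu smu] := states_nonempty B.
have s1 := state_comp th_mor smu; have s2 := state_comp ph_mor smu.
apply: (metrizes_states dom_coupled_sa coupled_sa_dense coupled_L_seminorm).
  move=> phi psi sphi spsi.
  apply: le_lt_trans (coupled_mk_dist_le smu sphi spsi) _.
  have [[fin1 _ _ _] _] := qcms_metrizes Q1.
  have [[fin2 _ _ _] _] := qcms_metrizes Q2.
  have /andP[_ f1] := fin1 _ _ (state_slice1 sphi s1) (state_slice1 spsi s1).
  have /andP[_ f2] := fin2 _ _ (state_slice2 sphi s2) (state_slice2 spsi s2).
  by rewrite !lte_add_pinfty // ltry.
move=> phi e sphi e0; have e3 : 0 < e / 3 by rewrite divr_gt0.
have n1 := near_precomp (qcms_near Q1 (state_slice1 sphi s1) e3).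
have n2 := near_precomp (qcms_near Q2 (state_slice2 sphi s2) e3).
have n3 : \forall psi \near (phi : {ptws (A1 * A2)%type -> R[i]^o}),
    eps * rnorm (phi (1, 0) - psi (1, 0)) < e / 3.
  have := near_eval phi (1, 0) (divr_gt0 e3 eps0).
  apply: (@filterS _ _ (nbhs_filter (phi : {ptws (A1 * A2)%type -> R[i]^o}))).
  by move=> psi; rewrite ltr_pdivlMr // mulrC.
have FF := nbhs_filter (phi : {ptws (A1 * A2)%type -> R[i]^o}).
apply: (@filterS _ _ FF) (@filterI _ _ FF _ _ (@filterI _ _ FF _ _ n1 n2) n3).
move=> psi [[h1 h2] h3] spsi.
apply: le_lt_trans (coupled_mk_dist_le smu sphi spsi) _.
have -> : e = e / 3 + e / 3 + e / 3 by field.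
rewrite !EFinD; apply: lteD; last by rewrite lte_fin.
by apply: lteD; [exact/h1/state_slice1|exact/h2/state_slice2].
Qed.

Lemma coupled_kernel :
  [set a | dom L a /\ L a = 0%E] = [set t%:C%:A | t in [set: R]].
Proof.
have ker1 := qcms_kernel Q1; have ker2 := qcms_kernel Q2.
have [L0 _ Lge0 _] := coupled_L_seminorm.
apply/seteqP; split => [[a1 a2] [/dom_coupled[d1 d2] La0]|_ [t _ <-]].
  have /(coupled_le th ph L1 L2 eps0)[/= l1 l2] : (L (a1, a2) <= 0%:E)%E.
    by rewrite La0.
  rewrite mulr0 => gap.
  have [_ _ ge1 _] := qcms_seminorm Q1; have [_ _ ge2 _] := qcms_seminorm Q2.
  have [t _ ta] : [set t%:C%:A | t in [set: R]] a1.
    by rewrite -ker1; split => //; apply/eqP; rewrite eq_le l1 ge1.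
  have [u _ ua] : [set t%:C%:A | t in [set: R]] a2.
    by rewrite -ker2; split => //; apply/eqP; rewrite eq_le l2 ge2.
  have tu : t = u.
    apply/eqP; rewrite -subr_eq0 -normr_le0 -(rnorm_scalar B).
    rewrite rmorphB scalerBl -(mor1 th_mor) -(morZ th_mor) (mor1 th_mor).
    by rewrite -(mor1 ph_mor) -(morZ ph_mor) ta ua.
  by exists t => //; rewrite -ta -ua -tu.
have [l1 L10] : [set a | dom L1 a /\ L1 a = 0%E] t%:C%:A.
  by rewrite ker1; exists t.
have [l2 L20] : [set a | dom L2 a /\ L2 a = 0%E] t%:C%:A.
  by rewrite ker2; exists t.
split; first by apply/dom_coupled.
apply/eqP; rewrite eq_le Lge0 andbT; apply/coupled_le => //=.
rewrite L10 L20 (morZ th_mor) (morZ ph_mor) (mor1 th_mor) (mor1 ph_mor).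
by rewrite subrr rnorm0 mulr0.
Qed.

Let norm_gap a : dom L a -> rnorm (th a.1 - ph a.2) <= eps * fine (L a).
Proof.
have [_ _ Lge0 _] := coupled_L_seminorm.
move=> La; have Lfin : L a \is a fin_num by rewrite ge0_fin_numE.
by have /coupled_le[] : (coupled th ph L1 L2 eps a <= (fine (L a))%:E)%E
  by rewrite fineK.
Qed.

(** The gap [th a1 th b1 - ph a2 ph b2] at a product is the sum of
    [th a1 (th b1 - ph b2)] and [(th a1 - ph a2) ph b2], where [th] and [ph] are
    contractive. *)
Lemma coupled_leibniz a b : dom L a -> dom L b ->
  (maxe (L (re_part (a * b)%R)) (L (im_part (a * b)%R)) <=
   (F (rnorm a) (rnorm b) (fine (L a)) (fine (L b)))%:E)%E.
Proof.
have [_ _ Lge0 _] := coupled_L_seminorm.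
have [_ _ ge1 _] := qcms_seminorm Q1; have [_ _ ge2 _] := qcms_seminorm Q2.
have [F_mono F_ge] := F_leibniz.
move=> La Lb.
have /dom_coupled[da1 da2] := La; have /dom_coupled[db1 db2] := Lb.
have fLa : 0 <= fine (L a) by exact/fine_ge0/Lge0.
have fLb : 0 <= fine (L b) by exact/fine_ge0/Lge0.
have le1 c : dom L c -> fine (L1 c.1) <= fine (L c).
  move=> Lc; have /dom_coupled[dc1 _] := Lc.
  by apply: fine_le; rewrite ?ge0_fin_numE //; exact: coupled_ge1.
have le2 c : dom L c -> fine (L2 c.2) <= fine (L c).
  move=> Lc; have /dom_coupled[_ dc2] := Lc.
  by apply: fine_le; rewrite ?ge0_fin_numE //; exact: coupled_ge2.
set FL := F _ _ _ _.
have F1 : F (rnorm a.1) (rnorm b.1) (fine (L1 a.1)) (fine (L1 b.1)) <= FL.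
  by apply: F_mono; rewrite ?rnorm_ge0 ?rnorm_fst ?fine_ge0 ?le1.
have F2 : F (rnorm a.2) (rnorm b.2) (fine (L2 a.2)) (fine (L2 b.2)) <= FL.
  by apply: F_mono; rewrite ?rnorm_ge0 ?rnorm_snd ?fine_ge0 ?le2.
have gap : rnorm (th a.1 * th b.1 - ph a.2 * ph b.2) <= eps * FL.
  have -> : th a.1 * th b.1 - ph a.2 * ph b.2 =
      th a.1 * (th b.1 - ph b.2) + (th a.1 - ph a.2) * ph b.2.
    by rewrite mulrBr mulrBl addrA subrK.
  rewrite (le_trans (rnormD _ _)) //.
  rewrite (le_trans (lerD (rnormM _ _) (rnormM _ _))) //.
  have := F_ge _ _ _ _ (rnorm_ge0 a) (rnorm_ge0 b) fLa fLb.
  rewrite -/FL -(ler_pM2l eps0); apply: le_trans; rewrite mulrDr lerD //.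
    rewrite mulrCA ler_pM ?rnorm_ge0 ?norm_gap //.
    exact: le_trans (mor_norm th_mor _) (rnorm_fst _).
  rewrite mulrCA mulrC ler_pM ?rnorm_ge0 ?norm_gap //.
  exact: le_trans (mor_norm ph_mor _) (rnorm_snd _).
have /andP[re1 im1] : (L1 (re_part (a.1 * b.1)%R) <= FL%:E)%E &&
    (L1 (im_part (a.1 * b.1)%R) <= FL%:E)%E.
  by rewrite -ge_max (le_trans (qcms_leibniz Q1 da1 db1)) // lee_fin.
have /andP[re2 im2] : (L2 (re_part (a.2 * b.2)%R) <= FL%:E)%E &&
    (L2 (im_part (a.2 * b.2)%R) <= FL%:E)%E.
  by rewrite -ge_max (le_trans (qcms_leibniz Q2 da2 db2)) // lee_fin.
rewrite ge_max; apply/andP; split; apply/(coupled_le th ph L1 L2 eps0);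
  split=> //; apply: le_trans _ gap.
- rewrite [th _](mor_re th_mor (a.1 * b.1)) [ph _](mor_re ph_mor (a.2 * b.2)).
  rewrite (morM th_mor) (morM ph_mor) -re_partB; exact: rnorm_re_part.
- rewrite [th _](mor_im th_mor (a.1 * b.1)) [ph _](mor_im ph_mor (a.2 * b.2)).
  rewrite (morM th_mor) (morM ph_mor) -im_partB; exact: rnorm_im_part.
Qed.

Theorem coupled_qcms : is_qcms F L.
Proof.
split.
- exact: dom_coupled_sa.
- exact: coupled_sa_dense.
- move=> a b /dom_coupled[a1 a2] /dom_coupled[b1 b2].
  have [re1 im1] := qcms_jordan_lie Q1 a1 b1.
  have [re2 im2] := qcms_jordan_lie Q2 a2 b2.
  by split; apply/dom_coupled.
- exact: coupled_L_seminorm.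
- exact: coupled_kernel.
- exact: coupled_metrizes.
- apply: coupled_lsc => //.
  + exact: mor_norm th_mor.
  + exact: mor_norm ph_mor.
  + exact: qcms_lsc Q1.
  + exact: qcms_lsc Q2.
- exact: coupled_leibniz.
Qed.

End CoupledQuantumMetric.

(** * The direct sum as a metrized quantum vector bundle *)

Section CoupledBundle.
Variables (R : realType) (F : R -> R -> R -> R -> R) (H : R -> R -> R).
Variables (X1 X2 Y : bundle R) (eps : R).
Variables (th : bundle_base X1 -> bundle_base Y).
Variables (Th : bundle_mod X1 -> bundle_mod Y).
Variables (ph : bundle_base X2 -> bundle_base Y).
Variables (Ph : bundle_mod X2 -> bundle_mod Y).

Definition coupled_bundle : bundle R :=
  @Bundle R (bundle_base X1 * bundle_base X2)%type
    (bundle_mod X1 * bundle_mod X2)%type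
    (coupled Th Ph (bundle_D X1) (bundle_D X2) eps)
    (coupled th ph (bundle_L X1) (bundle_L X2) eps).

Hypotheses (perm : permissible F H) (eps0 : 0 < eps).
Hypotheses (B1 : is_bundle F H X1) (B2 : is_bundle F H X2).
Hypotheses (th_mor : hilbert_morphism th Th) (ph_mor : hilbert_morphism ph Ph).

Let Th_lin : linear Th. Proof. by case: th_mor. Qed.
Let Ph_lin : linear Ph. Proof. by case: ph_mor. Qed.
Let Th_le w : rnorm (Th w) <= rnorm w. Proof. exact: hmor_norm th_mor w. Qed.
Let Ph_le w : rnorm (Ph w) <= rnorm w. Proof. exact: hmor_norm ph_mor w. Qed.

Let D := coupled Th Ph (bundle_D X1) (bundle_D X2) eps.
Let L := coupled th ph (bundle_L X1) (bundle_L X2) eps.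

Lemma coupled_D_seminorm : seminorm [set: R[i]] D.
Proof.
apply: coupled_seminorm => //; first exact: bundle_D_seminorm B1.
exact: bundle_D_seminorm B2.
Qed.

Let norm_gap w : dom D w -> rnorm (Th w.1 - Ph w.2) <= eps * fine (D w).
Proof.
have [_ _ Dge0 _] := coupled_D_seminorm.
move=> Dw; have Dfin : D w \is a fin_num by rewrite ge0_fin_numE.
by have /coupled_le[] : (coupled Th Ph (bundle_D X1) (bundle_D X2) eps w <=
  (fine (D w))%:E)%E by rewrite fineK.
Qed.

(** The gap between [th <w1, v1>] and [ph <w2, v2>] is that between
    [<Th w1, Th v1>] and [<Ph w2, Ph v2>], to which the Cauchy-Schwarz inequality
    applies. *)
Lemma coupled_inner_leibniz (w v : (bundle_mod X1 * bundle_mod X2)%type) :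
  dom D w -> dom D v ->
  (maxe (L (re_part (inner w v))) (L (im_part (inner w v))) <=
   (H (fine (D w)) (fine (D v)))%:E)%E.
Proof.
have [_ _ Dge0 _] := coupled_D_seminorm.
have [_ _ ge1 _] := bundle_D_seminorm B1.
have [_ _ ge2 _] := bundle_D_seminorm B2.
have [_ H_mono H_ge] := perm.
have [th_star _ _ th_inner] := th_mor; have [ph_star _ _ ph_inner] := ph_mor.
move=> Dw Dv.
have /dom_coupled[dw1 dw2] := Dw; have /dom_coupled[dv1 dv2] := Dv.
have fw : 0 <= fine (D w) by exact/fine_ge0/Dge0.
have fv : 0 <= fine (D v) by exact/fine_ge0/Dge0.
have le1 u : dom D u -> fine (bundle_D X1 u.1) <= fine (D u).
  move=> Du; have /dom_coupled[du1 _] := Du.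
  by apply: fine_le; rewrite ?ge0_fin_numE //; exact: coupled_ge1.
have le2 u : dom D u -> fine (bundle_D X2 u.2) <= fine (D u).
  move=> Du; have /dom_coupled[_ du2] := Du.
  by apply: fine_le; rewrite ?ge0_fin_numE //; exact: coupled_ge2.
set HD := H _ _.
have H1 : H (fine (bundle_D X1 w.1)) (fine (bundle_D X1 v.1)) <= HD.
  by apply: H_mono; rewrite ?fine_ge0 ?le1.
have H2 : H (fine (bundle_D X2 w.2)) (fine (bundle_D X2 v.2)) <= HD.
  by apply: H_mono; rewrite ?fine_ge0 ?le2.
have norm_le1 u : dom D u -> rnorm (Th u.1) <= fine (D u).
  move=> Du; apply: le_trans (Th_le _) (le_trans _ (le1 u Du)).
  have /dom_coupled[du1 _] := Du.
  by rewrite -lee_fin fineK ?ge0_fin_numE //; exact: bundle_D_ge B1 _.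
have norm_le2 u : dom D u -> rnorm (Ph u.2) <= fine (D u).
  move=> Du; apply: le_trans (Ph_le _) (le_trans _ (le2 u Du)).
  have /dom_coupled[_ du2] := Du.
  by rewrite -lee_fin fineK ?ge0_fin_numE //; exact: bundle_D_ge B2 _.
have gap :
    rnorm (inner (Th w.1) (Th v.1) - inner (Ph w.2) (Ph v.2)) <= eps * HD.
  have -> : inner (Th w.1) (Th v.1) - inner (Ph w.2) (Ph v.2) =
      inner (Th w.1 - Ph w.2) (Th v.1) + inner (Ph w.2) (Th v.1 - Ph v.2).
    by rewrite innerD innerNl innerDr innerNr addrA subrK.
  rewrite (le_trans (rnormD _ _)) //.
  rewrite (le_trans (lerD (cauchy_schwarz _ _) (cauchy_schwarz _ _))) //.
  have := H_ge _ _ fw fv; rewrite -/HD -(ler_pM2l eps0); apply: le_trans.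
  have -> : eps * (2 * fine (D w) * fine (D v)) =
      (eps * fine (D w)) * fine (D v) + fine (D w) * (eps * fine (D v)) by ring.
  by rewrite lerD // ler_pM ?rnorm_ge0 ?norm_gap ?norm_le1 ?norm_le2.
have /andP[re1 im1] : (bundle_L X1 (re_part (inner w.1 v.1)) <= HD%:E)%E &&
    (bundle_L X1 (im_part (inner w.1 v.1)) <= HD%:E)%E.
  by rewrite -ge_max (le_trans (bundle_leibniz B1 dw1 dv1)) // lee_fin.
have /andP[re2 im2] : (bundle_L X2 (re_part (inner w.2 v.2)) <= HD%:E)%E &&
    (bundle_L X2 (im_part (inner w.2 v.2)) <= HD%:E)%E.
  by rewrite -ge_max (le_trans (bundle_leibniz B2 dw2 dv2)) // lee_fin.
rewrite ge_max; apply/andP; split; apply/(coupled_le th ph _ _ eps0);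
  split=> //; apply: le_trans _ gap; rewrite -th_inner -ph_inner.
- rewrite [th _](mor_re th_star (inner w.1 v.1)).
  rewrite [ph _](mor_re ph_star (inner w.2 v.2)) -re_partB.
  exact: rnorm_re_part.
- rewrite [th _](mor_im th_star (inner w.1 v.1)).
  rewrite [ph _](mor_im ph_star (inner w.2 v.2)) -im_partB.
  exact: rnorm_im_part.
Qed.

Theorem coupled_bundleP : is_bundle F H coupled_bundle.
Proof.
have [F_leibniz _ _] := perm.
have [th_star _ _ _] := th_mor; have [ph_star _ _ _] := ph_mor.
split.
- exact: coupled_qcms (bundle_qcms B1) (bundle_qcms B2) th_star ph_star eps0.
- exact: coupled_D_seminorm.
- move=> [w1 w2] /= Dw0.
  have /(coupled_le Th Ph _ _ eps0)[/= d1 d2 _] : (D (w1, w2) <= 0%:E)%E.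
    by rewrite /D Dw0.
  have [_ _ ge1 _] := bundle_D_seminorm B1.
  have [_ _ ge2 _] := bundle_D_seminorm B2.
  congr pair.
    by apply: (bundle_D_eq0 B1); apply/eqP; rewrite eq_le d1 ge1.
  by apply: (bundle_D_eq0 B2); apply/eqP; rewrite eq_le d2 ge2.
- apply/seteqP; split=> // w _; apply: coupled_dense.
    by rewrite (bundle_D_dense B1).
  by rewrite (bundle_D_dense B2).
- move=> w.
  have n1 := le_trans (bundle_D_ge B1 w.1)
    (coupled_ge1 Th Ph _ (bundle_D X2) eps w).
  have n2 := le_trans (bundle_D_ge B2 w.2)
    (coupled_ge2 Th Ph (bundle_D X1) _ eps w).
  have : rnorm w <= Num.max (rnorm w.1) (rnorm w.2).
    by rewrite -rnorm_le prod_norm_le !rnorm_le !le_max !lexx orbT.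
  rewrite -lee_fin => /le_trans; apply.
  by rewrite EFin_max ge_max n1.
- by apply: coupled_compact => //; [exact: bundle_D_compact B1|
    exact: bundle_D_compact B2].
- exact: coupled_inner_leibniz.
Qed.

End CoupledBundle.

(** * Isometries from the direct sum *)

Section QuotientInfimum.
Variable R : realType.

Lemma ereal_inf_charac (T : Type) (S : set T) (N : T -> \bar R) (m : \bar R) :
  (forall z, S z -> (m <= N z)%E) ->
  (forall c, (m < c)%E -> exists2 z, S z & (N z < c)%E) ->
  m = ereal_inf [set N z | z in S].
Proof.
move=> lb glb; apply/eqP; rewrite eq_le; apply/andP; split.
  by apply: le_ereal_inf_tmp => _ [z Sz <-]; exact: lb.
rewrite leNgt; apply/negP => /glb[z Sz]; rewrite ltNge => /negP; apply.
by apply: ereal_inf_lbound; exists z.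
Qed.

(** An element [x] of [S1] with value below [c] maps to an element of [W] at which
    the quotient seminorm is below [c] too, and which therefore lifts along the
    other quotient map with a value below [c]. *)
Lemma common_lift (V1 V2 W : Type) (N1 : V1 -> \bar R) (N2 : V2 -> \bar R)
    (NW : W -> \bar R) (T1 : V1 -> W) (S1 : set V1) (S2 : W -> set V2)
    (c : \bar R) :
  (forall x, S1 x -> (NW (T1 x) <= N1 x)%E) ->
  (forall x, S1 x -> NW (T1 x) = ereal_inf [set N2 y | y in S2 (T1 x)]) ->
  (ereal_inf [set N1 x | x in S1] < c)%E ->
  exists x y, [/\ S1 x, S2 (T1 x) y, (N1 x < c)%E & (N2 y < c)%E].
Proof.
move=> le1 inf2 /ereal_inf_lt[_ [x Sx <-] xc].
have := le_lt_trans (le1 x Sx) xc; rewrite inf2 //.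
by move=> /ereal_inf_lt[_ [y Sy <-] yc]; exists x, y.
Qed.

Lemma coupled_matched (V1 V2 W : normedModType R[i]) (T1 : V1 -> W)
    (T2 : V2 -> W) (N1 : V1 -> \bar R) (N2 : V2 -> \bar R) (eps : R) x y c :
  T1 x = T2 y -> (0 <= N1 x)%E -> (N1 x < c)%E -> (N2 y < c)%E ->
  (coupled T1 T2 N1 N2 eps (x, y) < c)%E.
Proof.
move=> xy N1x xc yc; rewrite /coupled /= xy subrr rnorm0 mulr0 !gt_max xc yc.
exact: le_lt_trans N1x xc.
Qed.

End QuotientInfimum.

Section CoupledIsometries.
Variables (R : realType) (X1 X2 Y Z : bundle R) (eps : R).
Variables (th : bundle_base X1 -> bundle_base Y).
Variables (Th : bundle_mod X1 -> bundle_mod Y).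
Variables (ph : bundle_base X2 -> bundle_base Y).
Variables (Ph : bundle_mod X2 -> bundle_mod Y).
Hypotheses (th_iso : modular_isometry th Th) (ph_iso : modular_isometry ph Ph).

Let isometry_inf (X X' : bundle R) (q : bundle_base X -> bundle_base X')
    (Q : bundle_mod X -> bundle_mod X') : modular_isometry q Q ->
  [/\ forall b, sa _ b -> bundle_L X' b =
        ereal_inf [set bundle_L X a | a in [set a | sa _ a /\ q a = b]],
      forall w, bundle_D X' w =
        ereal_inf [set bundle_D X v | v in [set v | Q v = w]],
      star_morphism q & linear Q].
Proof. by case=> [[sm lQ _ _] [_ _ infL] _ infD]. Qed.

Let isometry_le (X X' : bundle R) (q : bundle_base X -> bundle_base X')
    (Q : bundle_mod X -> bundle_mod X') : modular_isometry q Q ->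
  (forall a, sa _ a -> (bundle_L X' (q a) <= bundle_L X a)%E) /\
  (forall w, (bundle_D X' (Q w) <= bundle_D X w)%E).
Proof.
move=> /isometry_inf[infL infD sm _]; split.
  move=> a sa_a; rewrite infL; last exact: mor_sa.
  by apply: ereal_inf_lbound; exists a.
by move=> w; rewrite infD; apply: ereal_inf_lbound; exists w.
Qed.

Section First.
Variable q : bundle_base X1 -> bundle_base Z.
Variable Q : bundle_mod X1 -> bundle_mod Z.
Hypothesis q_iso : modular_isometry q Q.
Hypothesis L1_ge0 : forall a, (0 <= bundle_L X1 a)%E.
Hypothesis D1_ge0 : forall w, (0 <= bundle_D X1 w)%E.

(** The fibers are compared by [common_lift]: a nearly optimal lift to [X1] is
    completed by an element of [X2] with the same image in [Y], so that the gap
    contributes nothing. *)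
Lemma coupled_isometry_fst :
  @modular_isometry R (coupled_bundle eps th Th ph Ph) Z
    (fun d => q d.1) (fun w => Q w.1).
Proof.
have [q_hmor [_ q_surj _] Q_surj _] := q_iso.
have [qL qD q_mor _] := isometry_inf q_iso.
have [thL thD th_mor _] := isometry_inf th_iso.
have [phL phD ph_mor _] := isometry_inf ph_iso.
have [th_leL th_leD] := isometry_le th_iso.
have [q_leL q_leD] := isometry_le q_iso.
split.
- exact: hilbert_morphism_fst.
- split; first exact: star_morphism_fst.
  + by move=> b; have [a <-] := q_surj b; exists (a, 0).
  + move=> b sb; apply: ereal_inf_charac.
      move=> [a1 a2] [[sa1 _] /= <-].
      apply: le_trans (q_leL _ sa1) _.
      exact: (coupled_ge1 _ _ _ _ _ (a1, a2)).
    move=> c; rewrite (qL _ sb) => lt_c.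
    have [||a1 [a2 [[sa1 qa] [sa2 pa] c1 c2]]] :=
      common_lift (N2 := bundle_L X2) (NW := bundle_L Y) (T1 := th)
      (S2 := fun w => [set a | sa _ a /\ ph a = w]) _ _ lt_c.
    * by move=> a [/th_leL].
    * by move=> a [/(mor_sa th_mor) /phL].
    exists (a1, a2); first by split => //; rewrite /sa /=; congr pair.
    exact: coupled_matched.
- by move=> w; have [v <-] := Q_surj w; exists (v, 0).
- move=> w; apply: ereal_inf_charac.
    move=> [w1 w2] /= <-; apply: le_trans (q_leD w1) _.
    exact: (coupled_ge1 _ _ _ _ _ (w1, w2)).
  move=> c; rewrite qD => lt_c.
  have [||w1 [w2 [Qw Pw c1 c2]]] := common_lift (N2 := bundle_D X2)
    (NW := bundle_D Y) (T1 := Th) (S2 := fun w => [set v | Ph v = w]) _ _ lt_c.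
  + by move=> v _.
  + by move=> v _.
  exists (w1, w2) => //.
  exact: coupled_matched.
Qed.

End First.

Section Second.
Variable q : bundle_base X2 -> bundle_base Z.
Variable Q : bundle_mod X2 -> bundle_mod Z.
Hypothesis q_iso : modular_isometry q Q.
Hypothesis L1_ge0 : forall a, (0 <= bundle_L X1 a)%E.
Hypothesis D1_ge0 : forall w, (0 <= bundle_D X1 w)%E.

Lemma coupled_isometry_snd :
  @modular_isometry R (coupled_bundle eps th Th ph Ph) Z
    (fun d => q d.2) (fun w => Q w.2).
Proof.
have [q_hmor [_ q_surj _] Q_surj _] := q_iso.
have [qL qD q_mor _] := isometry_inf q_iso.
have [thL thD th_mor _] := isometry_inf th_iso.
have [phL phD ph_mor _] := isometry_inf ph_iso.
have [ph_leL ph_leD] := isometry_le ph_iso.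
have [q_leL q_leD] := isometry_le q_iso.
split.
- exact: hilbert_morphism_snd.
- split; first exact: star_morphism_snd.
  + by move=> b; have [a <-] := q_surj b; exists (0, a).
  + move=> b sb; apply: ereal_inf_charac.
      move=> [a1 a2] [[_ sa2] /= <-].
      apply: le_trans (q_leL _ sa2) _.
      exact: (coupled_ge2 _ _ _ _ _ (a1, a2)).
    move=> c; rewrite (qL _ sb) => lt_c.
    have [||a2 [a1 [[sa2 qa] [sa1 ta] c2 c1]]] :=
      common_lift (N2 := bundle_L X1) (NW := bundle_L Y) (T1 := ph)
      (S2 := fun w => [set a | sa _ a /\ th a = w]) _ _ lt_c.
    * by move=> a [/ph_leL].
    * by move=> a [/(mor_sa ph_mor) /thL].
    exists (a1, a2); first by split => //; rewrite /sa /=; congr pair.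
    exact: coupled_matched.
- by move=> w; have [v <-] := Q_surj w; exists (0, v).
- move=> w; apply: ereal_inf_charac.
    move=> [w1 w2] /= <-; apply: le_trans (q_leD w2) _.
    exact: (coupled_ge2 _ _ _ _ _ (w1, w2)).
  move=> c; rewrite qD => lt_c.
  have [||w2 [w1 [Qw Tw c2 c1]]] := common_lift (N2 := bundle_D X1)
    (NW := bundle_D Y) (T1 := Ph) (S2 := fun w => [set v | Th v = w]) _ _ lt_c.
  + by move=> v _.
  + by move=> v _.
  exists (w1, w2) => //.
  exact: coupled_matched.
Qed.

End Second.

End CoupledIsometries.

(** * Extents *)

Section Extents.
Variable R : realType.

Lemma hausdorff_quotient_le (A D : cstarType R) (L : D -> \bar R) (q : D -> A)
    (K : \bar R) :
  L 0 = 0%E -> star_morphism q -> (0 <= K)%E ->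
  (forall phi, states D phi -> (ereal_inf [set mk_dist L phi psi |
     psi in [set mu \o q | mu in states A]] <= K)%E) ->
  (hausdorff_dist (mk_dist L) (states D) [set mu \o q | mu in states A] <= K)%E.
Proof.
move=> L0 q_mor K0 le; rewrite /hausdorff_dist ge_max; apply/andP; split.
  by apply: ge_ereal_sup => _ [phi sphi <-]; exact: le.
apply: ge_ereal_sup => _ [_ [mu smu <-] <-]; apply: ge_ereal_inf.
exists 0%E => //; exists (mu \o q); first exact: state_comp.
exact: mk_dist_refl.
Qed.

Lemma hausdorff_reach (A D : cstarType R) (L : D -> \bar R) (q : D -> A)
    (r e : R) phi :
  (hausdorff_dist (mk_dist L) (states D) [set mu \o q | mu in states A] <=
   r%:E)%E -> 0 < e -> states D phi ->
  exists2 mu, states A mu &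
    forall d, (L d <= 1)%E -> rnorm (phi d - mu (q d)) <= r + e.
Proof.
rewrite /hausdorff_dist ge_max => /andP[+ _] e0 sphi => sup_le.
have : (ereal_inf [set mk_dist L phi psi |
    psi in [set mu \o q | mu in states A]] < (r + e)%:E)%E.
  apply: le_lt_trans (_ : (_ <= r%:E)%E) _; last by rewrite lte_fin ltrDl.
  by apply: le_trans sup_le; apply: ereal_sup_ubound; exists phi.
move=> /ereal_inf_lt[_ [_ [mu smu <-] <-] dist]; exists mu => // d Ld.
rewrite -lee_fin; apply: le_trans (ltW dist).
exact: (mk_dist_ub phi (mu \o q) Ld).
Qed.

Lemma hausdorff_ge0 (A D : cstarType R) (L : D -> \bar R) (q : D -> A) :
  L 0 = 0%E ->
  (0 <= hausdorff_dist (mk_dist L) (states D) [set mu \o q | mu in states A])%E.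
Proof.
move=> L0; have [phi sphi] := states_nonempty D.
rewrite /hausdorff_dist le_max; apply/orP; left.
apply: (@le_trans _ _ (ereal_inf [set mk_dist L phi psi |
    psi in [set mu \o q | mu in states A]])).
  by apply: le_ereal_inf_tmp => _ [psi _ <-]; exact: mk_dist_ge0.
by apply: ereal_sup_ubound; exists phi.
Qed.

(** The second state reaches [C] through a state [nu] of the common quotient [B]:
    the two pullbacks of [nu] differ by at most the allowed gap. *)
Lemma reach_through_quotient (A1 A2 B C : cstarType R) (L1 : A1 -> \bar R)
    (L2 : A2 -> \bar R) (q : A1 -> C) (th : A1 -> B) (ph : A2 -> B)
    (r1 r2 eps t : R) phi1 phi2 :
  (forall a, (L1 a <= 1)%E -> sa A1 a) ->
  (forall a, (L2 a <= 1)%E -> sa A2 a) ->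
  star_morphism th -> star_morphism ph -> 0 <= r2 -> 0 <= eps ->
  (forall phi, states A1 phi -> exists2 mu, states C mu &
     forall a, (L1 a <= 1)%E -> rnorm (phi a - mu (q a)) <= r1) ->
  (forall phi, states A2 phi -> exists2 nu, states B nu &
     forall a, (L2 a <= 1)%E -> rnorm (phi a - nu (ph a)) <= r2) ->
  0 <= t <= 1 -> states A1 phi1 -> states A2 phi2 ->
  exists2 mu, states C mu & forall a1 a2,
    (L1 a1 <= 1)%E -> (L2 a2 <= 1)%E -> rnorm (th a1 - ph a2) <= eps ->
    rnorm ((t%:C * phi1 a1 + (1 - t)%:C * phi2 a2 : R[i]^o) - mu (q a1)) <=
      r1 + r2 + eps.
Proof.
move=> sa1 sa2 th_mor ph_mor r20 eps_ge0 reach1 reach2 t01 s1 s2.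
have [mu1 smu1 mu1P] := reach1 _ s1.
have [nu snu nuP] := reach2 _ s2.
have [mu2 smu2 mu2P] := reach1 _ (state_comp th_mor snu).
have /andP[t0 t1] := t01.
exists (fun c => t%:C * mu1 c + (1 - t)%:C * mu2 c); first exact: state_convex.
move=> a1 a2 La1 La2 gap.
have sgap : sa B (th a1 - ph a2).
  by apply: saB; [apply: (mor_sa th_mor); exact: sa1|
                  apply: (mor_sa ph_mor); exact: sa2].
have n1 := mu1P _ La1; have n2 := nuP _ La2; have n3 := mu2P _ La1.
have n4 := le_trans (state_sa_norm snu sgap) gap.
set x1 : R[i]^o := phi1 a1 - mu1 (q a1) in n1.
set x2 : R[i]^o := phi2 a2 - nu (ph a2) in n2.
set x3 : R[i]^o := (nu \o th) a1 - mu2 (q a1) in n3.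
set x4 : R[i]^o := nu (th a1 - ph a2) in n4.
have -> : (t%:C * phi1 a1 + (1 - t)%:C * phi2 a2 : R[i]^o) -
    (t%:C * mu1 (q a1) + (1 - t)%:C * mu2 (q a1)) =
    t%:C *: x1 + (1 - t)%:C *: (x2 + x3 - x4) :> R[i]^o.
  rewrite /x4 (pfunB (state_positive snu)) /x1 /x2 /x3 /GRing.scale /=; ring.
have h1 := rnormD (t%:C *: x1) ((1 - t)%:C *: (x2 + x3 - x4)).
have h2 : rnorm (x2 + x3 - x4) <= r2 + r1 + eps.
  rewrite (le_trans (rnormB _ _)) // lerD // (le_trans (rnormD _ _)) //.
  exact: lerD.
apply: le_trans h1 _; rewrite !rnormZ !ger0_norm ?subr_ge0 //.
move: (rnorm x1) (rnorm (x2 + x3 - x4)) n1 h2 => u v; nra.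
Qed.

Section CoupledExtents.
Variables (A1 A2 B : cstarType R) (L1 : A1 -> \bar R) (L2 : A2 -> \bar R).
Variables (th : A1 -> B) (ph : A2 -> B) (eps : R).
Hypotheses (sa1 : dom L1 `<=` sa A1) (sa2 : dom L2 `<=` sa A2).
Hypotheses (L10 : L1 0 = 0%E) (L20 : L2 0 = 0%E).
Hypotheses (th_mor : star_morphism th) (ph_mor : star_morphism ph).
Hypothesis eps0 : 0 < eps.

Let L := coupled th ph L1 L2 eps.

Let L0 : L 0 = 0%E.
Proof.
rewrite /L /coupled /= L10 L20 (mor0 th_mor) (mor0 ph_mor).
by rewrite subrr rnorm0 mulr0 !maxxx.
Qed.

Let haus (A D : cstarType R) (N : D -> \bar R) (q : D -> A) :=
  hausdorff_dist (mk_dist N) (states D) [set mu \o q | mu in states A].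

(** For infinite extents there is nothing to prove, and for finite ones the
    infima are only approached. *)
Let haus_sum_le (C D : cstarType R) (N : D -> \bar R) (q : D -> C) x1 x2 :
  N 0 = 0%E -> star_morphism q -> (0 <= x1)%E -> (0 <= x2)%E ->
  (forall r1 r2 e phi, x1 = r1%:E -> x2 = r2%:E -> 0 < e -> states D phi ->
     exists2 mu, states C mu & forall d, (N d <= 1)%E ->
       rnorm (phi d - mu (q d)) <= (r1 + e) + (r2 + e) + eps) ->
  (haus N q <= x1 + x2 + eps%:E)%E.
Proof.
move=> N0 q_mor x10 x20 reach.
have e0 : (0 <= eps%:E)%E by rewrite lee_fin ltW.
apply: hausdorff_quotient_le => //; first by rewrite !adde_ge0.
move=> phi sphi.
case: x1 x10 reach => [r1||//] x10; last first.
  by rewrite addye ?addye ?leey // gt_eqF // (lt_le_trans _ x20).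
case: x2 x20 => [r2||//] x20 reach; last by rewrite addey // addye // leey.
apply/lee_addgt0Pr => e e_gt0; have e2 : 0 < e / 2 by rewrite divr_gt0.
have [mu smu muP] := reach r1 r2 (e / 2) phi erefl erefl e2 sphi.
apply: ge_ereal_inf; exists (mk_dist N phi (mu \o q)).
  by exists (mu \o q) => //; exists mu.
apply: mk_dist_le => d Nd; rewrite -!EFinD lee_fin.
by apply: le_trans (muP d Nd) _; lra.
Qed.

Lemma coupled_hausdorff_fst (C : cstarType R) (q : A1 -> C) :
  star_morphism q ->
  (haus L (fun d : (A1 * A2)%type => q d.1) <=
   haus L1 q + haus L2 ph + eps%:E)%E.
Proof.
move=> q_mor; apply: haus_sum_le; rewrite ?hausdorff_ge0 //.
  exact: star_morphism_fst.
move=> r1 r2 e phi h1 h2 e0 sphi.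
have [t [phi1 [phi2 [t01 s1 s2 phiE]]]] := state_decomposition sphi.
have r20 : 0 <= r2 by rewrite -lee_fin -h2 hausdorff_ge0.
have [|||||mu smu muP] := @reach_through_quotient A1 A2 B C L1 L2 q th ph
  (r1 + e) (r2 + e) eps t phi1 phi2 _ _ th_mor ph_mor _ (ltW eps0)
  _ _ t01 s1 s2.
- by move=> a La; apply: sa1; exact: le_lt_trans La (ltry _).
- by move=> a La; apply: sa2; exact: le_lt_trans La (ltry _).
- by rewrite addr_ge0 // ltW.
- by move=> psi; apply: hausdorff_reach => //; rewrite -h1.
- by move=> psi; apply: hausdorff_reach => //; rewrite -h2.
exists mu => // d /(coupled_le th ph L1 L2 eps0)[Ld1 Ld2].
by rewrite mulr1 phiE; exact: muP.
Qed.

Lemma coupled_hausdorff_snd (C : cstarType R) (q : A2 -> C) :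
  star_morphism q ->
  (haus L (fun d : (A1 * A2)%type => q d.2) <=
   haus L1 th + haus L2 q + eps%:E)%E.
Proof.
move=> q_mor; apply: haus_sum_le; rewrite ?hausdorff_ge0 //.
  exact: star_morphism_snd.
move=> r1 r2 e phi h1 h2 e0 sphi.
have [t [phi1 [phi2 [t01 s1 s2 phiE]]]] := state_decomposition sphi.
have r10 : 0 <= r1 by rewrite -lee_fin -h1 hausdorff_ge0.
have t01' : 0 <= 1 - t <= 1.
  by move: t01 => /andP[t0 t1]; apply/andP; split; lra.
have [|||||mu smu muP] := @reach_through_quotient A2 A1 B C L2 L1 q ph th
  (r2 + e) (r1 + e) eps (1 - t) phi2 phi1 _ _ ph_mor th_mor _ (ltW eps0)
  _ _ t01' s2 s1.
- by move=> a La; apply: sa2; exact: le_lt_trans La (ltry _).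
- by move=> a La; apply: sa1; exact: le_lt_trans La (ltry _).
- by rewrite addr_ge0 // ltW.
- by move=> psi; apply: hausdorff_reach => //; rewrite -h2.
- by move=> psi; apply: hausdorff_reach => //; rewrite -h1.
exists mu => // d /(coupled_le th ph L1 L2 eps0)[Ld1 Ld2].
rewrite mulr1 phiE rnorm_distC => gap.
have -> : t%:C * phi1 d.1 + (1 - t)%:C * phi2 d.2 =
    (1 - t)%:C * phi2 d.2 + (1 - (1 - t))%:C * phi1 d.1 by rewrite subKr addrC.
have -> : r1 + e + (r2 + e) + eps = r2 + e + (r1 + e) + eps by ring.
exact: muP.
Qed.

End CoupledExtents.

End Extents.

Theorem theorem3p11 (R : realType) (F : R -> R -> R -> R -> R)
    (H : R -> R -> R) (A B E : bundle R) (tau1 : tunnel A B)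
    (tau2 : tunnel B E) (eps : R) :
  permissible F H ->
  is_bundle F H A -> is_bundle F H B -> is_bundle F H E ->
  is_tunnel F H tau1 -> is_tunnel F H tau2 ->
  0 < eps ->
  let D1 := tun_bundle tau1 in
  let D2 := tun_bundle tau2 in
  let L (d : (bundle_base D1 * bundle_base D2)%type) : \bar R :=
    maxe (maxe (bundle_L D1 d.1) (bundle_L D2 d.2))
         (1 / eps * rnorm (tun_base2 tau1 d.1 - tun_base1 tau2 d.2))%:E in
  let D (w : (bundle_mod D1 * bundle_mod D2)%type) : \bar R :=
    maxe (maxe (bundle_D D1 w.1) (bundle_D D2 w.2))
         (1 / eps * rnorm (tun_mod2 tau1 w.1 - tun_mod1 tau2 w.2))%:E in
  let DD : bundle R :=
    @Bundle R (bundle_base D1 * bundle_base D2)%type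
      (bundle_mod D1 * bundle_mod D2)%type D L in
  let tau : tunnel A E :=
    @Tunnel R A E DD
      (fun d => tun_base1 tau1 d.1) (fun w => tun_mod1 tau1 w.1)
      (fun d => tun_base2 tau2 d.2) (fun w => tun_mod2 tau2 w.2) in
  [/\ is_bundle F H DD, is_tunnel F H tau &
      (extent tau <= extent tau1 + extent tau2 + eps%:E)%E].
Proof.
move=> perm _ BB _ [BD1 isoA isoB] [BD2 isoB' isoE] eps0 D1 D2 L D DD tau.
have [[thA_mor _ _ _] _ _ _] := isoA.
have [th_hmor [th_mor _ _] _ _] := isoB.
have [ph_hmor [ph_mor _ _] _ _] := isoB'.
have [_ [phE_mor _ _] _ _] := isoE.
have DD_bundle : is_bundle F H DD.
  exact: coupled_bundleP perm eps0 BD1 BD2 th_hmor ph_hmor.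
have [L10 _ L1_ge0 _] := qcms_seminorm (bundle_qcms BD1).
have [L20 _ _ _] := qcms_seminorm (bundle_qcms BD2).
have [_ _ D1_ge0 _] := bundle_D_seminorm BD1.
split=> //.
  split=> //; first exact: (coupled_isometry_fst eps isoB isoB' isoA).
  exact: (coupled_isometry_snd eps isoB isoB' isoE).
have sa1 := qcms_sa (bundle_qcms BD1); have sa2 := qcms_sa (bundle_qcms BD2).
have leA := coupled_hausdorff_fst sa1 sa2 L10 L20 th_mor ph_mor eps0 thA_mor.
have leE := coupled_hausdorff_snd sa1 sa2 L10 L20 th_mor ph_mor eps0 phE_mor.
rewrite {1}/extent ge_max; apply/andP; split.
  by apply: le_trans leA _; rewrite leeD2r // leeD // /extent le_max lexx ?orbT.
by apply: le_trans leE _; rewrite leeD2r // leeD // /extent le_max lexx ?orbT.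
Qed.
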